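(* Let $\sigma_0$ be an implicit signature and let $\mathsf{H}$ be a pseudovariety of groups that is graph $\sigma_0$-reducible. Let $\mathsf{V}=\mathsf{DO}\cap\overline{\mathsf{H}}$ and let $\sigma=\sigma_0\cup\{\_^\omega\}$. Suppose that $S$ is a finite semigroup, $A$ is a finite set, $\varphi:\overline{\Omega}_A\mathsf{S}\to S$ is an onto continuous homomorphism, and $\{s_1,\ldots,s_n\}$ is a $\mathsf{V}$-idempotent pointlike subset of $S$. Given $u_1,\ldots,u_n\in\overline{\Omega}_A\mathsf{S}$ such that $\varphi(u_i)=s_i$ ($i=1,\ldots,n$) and $$p_{\mathsf{V}}(u_1)=\cdots=p_{\mathsf{V}}(u_n)=p_{\mathsf{V}}(u_n^2),$$ there exist $w_1,\ldots,w_n\in\Omega^\sigma_A\mathsf{S}$ such that $$\varphi(w_i)=s_i\ (i=1,\ldots,n)\quad\text{and}\quad p_{\mathsf{V}}(w_1)=\cdots=p_{\mathsf{V}}(w_n)=p_{\mathsf{V}}(w_n^2).$$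
   Context: $\mathsf{S}$ is the pseudovariety of all finite semigroups, and for a finite set $A$, $\overline{\Omega}_A\mathsf{S}$ is the free profinite semigroup on $A$; its elements are called pseudowords. For a pseudovariety $\mathsf{V}$ of semigroups, $\overline{\Omega}_A\mathsf{V}$ is the free pro-$\mathsf{V}$ semigroup on $A$ and $p_{\mathsf{V}}:\overline{\Omega}_A\mathsf{S}\to\overline{\Omega}_A\mathsf{V}$ is the canonical projection. $\mathsf{DO}$ is the pseudovariety of all finite semigroups in which every regular $\mathcal{J}$-class is a subsemigroup isomorphic to a direct product of a rectangular band and a group. For a pseudovariety $\mathsf{H}$ of groups, $\overline{\mathsf{H}}$ is the pseudovariety of all finite semigroups all of whose subgroups lie in $\mathsf{H}$. So $\mathsf{DO}\cap\overline{\mathsf{H}}$ consists of all finite semigroups in which every regular $\mathcal{J}$-class is the product of a rectangular band by a group from $\mathsf{H}$. An implicit signature is a set $\sigma$ of pseudowords (elements of finitely generated free profinite semigroups, viewed as implicit operations) that contains binary multiplication. Pseudowords have a natural interpretation as operations on every profinite semigroup, so every profinite semigroup is a $\sigma$-algebra; $\Omega^\sigma_A\mathsf{S}$ is the $\sigma$-subalgebra of $\overline{\Omega}_A\mathsf{S}$ generated by $A$. The operation $\_^\omega$ is the unary operation which in a finite semigroup maps $x$ to its unique idempotent power $x^\omega$. A nonempty subset $P$ of a finite semigroup $S$ is $\mathsf{V}$-idempotent pointlike if for every finite set $A$ and every onto continuous homomorphism $\varphi:\overline{\Omega}_A\mathsf{S}\to S$ there is a subset $P'\subseteq\overline{\Omega}_A\mathsf{S}$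 such that $\varphi(P')=P$ and $p_{\mathsf{V}}(P')$ is a singleton consisting of an idempotent. Graph reducibility: to a finite directed graph $\Gamma$ (viewed as the disjoint union of its vertices and edges, all regarded as variables) associate the system consisting of the equation $xy=z$ for each edge $y$ from vertex $x$ to vertex $z$. Constraints in a finite semigroup $S$ are given by a function $\psi:\Gamma\to S$. Given a continuous onto homomorphism $\varphi:\overline{\Omega}_A\mathsf{S}\to S$, a $\mathsf{V}$-solution of the constrained system is a function $\gamma:\Gamma\to\overline{\Omega}_A\mathsf{S}$ such that $\varphi(\gamma(x))=\psi(x)$ for every $x\in\Gamma$ (vertex or edge) and $p_{\mathsf{V}}(\gamma(x)\gamma(y))=p_{\mathsf{V}}(\gamma(z))$ for every edge $y$ from $x$ to $z$. $\mathsf{V}$ is graph $\sigma$-reducible if every constrained system associated with a finite directed graph $\Gamma$ that admits a $\mathsf{V}$-solution also admits a $\mathsf{V}$-solution $\gamma$ with $\gamma(\Gamma)\subseteq\Omega^\sigma_A\mathsf{S}$. *)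

(* Defs.v *)
From HB Require Import structures.
From mathcomp Require Import all_boot.
From mathcomp Require Import zify.
From mathcomp Require Import boolp classical_sets functions topology.

Set Implicit Arguments.
Unset Strict Implicit.
Unset Printing Implicit Defensive.

Local Open Scope classical_set_scope.
Local Open Scope group_scope.

(* The empty semigroup is not excluded by this structure. It has no
   influence below: pseudovarieties are required to be closed under nonempty
   subsemigroups only, so they may or may not contain it. *)
#[short(type="finSemigroupType")]
HB.structure Definition FinSemigroup := {S of Semigroup S & Finite S}.

HB.instance Definition _ (S T : finSemigroupType) := Finite.on (S * T)%type.

Definition semigroup_class := finSemigroupType -> Prop.

(* Closure under finite direct products is split into the empty product (any
   one-element semigroup) and binary products; closure under isomorphism is
   part of [pv_image]. *)
Record pseudovariety (V : semigroup_class) : Prop := Pseudovariety {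
  pv_image : forall (S T : finSemigroupType) (f : {multiplicative S -> T}),
    V S -> (forall t, exists s, f s = t) -> V T;
  pv_sub : forall (S T : finSemigroupType) (f : {multiplicative T -> S}),
    V S -> inhabited T -> injective f -> V T;
  pv_trivial : forall S : finSemigroupType, #|S| = 1%N -> V S;
  pv_prod : forall S T : finSemigroupType, V S -> V T -> V (S * T)%type
}.

Definition is_group (S : finSemigroupType) : Prop :=
  exists e : S, (forall x : S, e * x = x /\ x * e = x) /\
                (forall x : S, exists y : S, y * x = e /\ x * y = e).

Definition group_pseudovariety (H : semigroup_class) : Prop :=
  pseudovariety H /\ forall S, H S -> is_group S.

Definition all_semigroups : semigroup_class := fun _ => True.

(* Subgroups of S are the images of the injective homomorphisms from groups. *)
Definition subgroups_in (H : semigroup_class) : semigroup_class := fun S =>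
  forall (G : finSemigroupType) (f : {multiplicative G -> S}),
    is_group G -> injective f -> H G.

Definition rectangular_band (B : finSemigroupType) : Prop :=
  forall x y : B, x * x = x /\ x * y * x = x.

Section Green.
Variable S : finSemigroupType.

(* x lies in the ideal S^1 y S^1 *)
Definition leJ (x y : S) : Prop :=
  [\/ x = y, exists a, x = a * y, exists b, x = y * b
    | exists a b, x = a * y * b].

Definition Jclass (x : S) : set S := [set y | leJ x y /\ leJ y x].

Definition regular (x : S) : Prop := exists y, x * y * x = x.

End Green.

Definition DO : semigroup_class := fun S =>
  forall x : S, regular x ->
    exists B G : finSemigroupType, rectangular_band B /\ is_group G /\
      exists f : {multiplicative (B * G)%type -> S},
        injective f /\ range f = Jclass x.

Definition DO_bar (H : semigroup_class) : semigroup_class :=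
  fun S => DO S /\ subgroups_in H S.

Section FreeProV.
Variables (V : semigroup_class) (A : finType).

(* The free pro-V semigroup on A, as the projective limit of all semigroups
   S of V equipped with a map f : A -> S: its elements are the families of
   elements of the S, indexed by the pairs (S, f), that are compatible with
   homomorphisms. Equivalently, they are the A-ary implicit operations on V. *)
Record freeProV := FreeProV {
  pw_eval :> forall S : finSemigroupType, V S -> (A -> S) -> S;
  pw_natural : forall (S T : finSemigroupType) (VS : V S) (VT : V T)
      (h : {multiplicative S -> T}) (f : A -> S),
    h (pw_eval VS f) = pw_eval VT (h \o f)
}.

Lemma freeProV_ext (v w : freeProV) :
  (forall S (VS : V S) (f : A -> S), v S VS f = w S VS f) -> v = w.
Proof.
case: v w => [v nv] [w nw] /= vw.
have E : v = w.
  by apply/functional_extensionality_dep => S; apply/funext => VS;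
     apply/funext => f; exact: vw.
by case: w / E nw {vw} => nw; congr FreeProV; exact: Prop_irrelevance.
Qed.

HB.instance Definition _ := gen_eqMixin freeProV.
HB.instance Definition _ := gen_choiceMixin freeProV.

Lemma pw_mul_natural (v w : freeProV) (S T : finSemigroupType)
    (VS : V S) (VT : V T) (h : {multiplicative S -> T}) (f : A -> S) :
  h (v S VS f * w S VS f) = v T VT (h \o f) * w T VT (h \o f).
Proof. by rewrite gmulfM !(pw_natural _ VS VT). Qed.

Definition pw_mul (v w : freeProV) : freeProV :=
  FreeProV (pw_mul_natural v w).

Lemma pw_mulA : associative pw_mul.
Proof. by move=> u v w; apply: freeProV_ext => S VS f /=; rewrite mulgA. Qed.

HB.instance Definition _ := hasMul.Build freeProV pw_mul.
HB.instance Definition _ := Magma_isSemigroup.Build freeProV pw_mulA.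

(* The topology induced by the product of the discrete semigroups S over all
   pairs (S, f). *)
Record marked := Marked {
  mk_sort : finSemigroupType;
  mk_class : V mk_sort;
  mk_map : A -> mk_sort
}.

HB.instance Definition _ := gen_eqMixin marked.
HB.instance Definition _ := gen_choiceMixin marked.

Definition pw_family (w : freeProV) :
    prod_topology (fun i : marked => discrete_topology (mk_sort i)) :=
  fun i => w (mk_sort i) (mk_class i) (@mk_map i).

HB.instance Definition _ :=
  Topological.copy freeProV (initial_topology pw_family).

Definition pw_gen (a : A) : freeProV :=
  @FreeProV (fun S _ f => f a) (fun S T VS VT h f => erefl).

End FreeProV.

Notation pseudoword := (freeProV all_semigroups).

Definition pw_proj (V : semigroup_class) (A : finType) (w : pseudoword A) :
    freeProV V A :=
  @FreeProV V A (fun S _ f => w S Logic.I f)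
    (fun S T _ _ h f => pw_natural w Logic.I Logic.I h f).

(* The operation defined by an n-ary pseudoword on the free profinite
   semigroup on A: [pw_op w t] is the image of w under the unique continuous
   homomorphism that maps the i-th generator to t i. *)
Section Interpretation.
Variables (n : nat) (A : finType).
Variables (w : pseudoword 'I_n) (t : 'I_n -> pseudoword A).

Lemma pw_op_natural (S T : finSemigroupType)
    (IS : all_semigroups S) (IT : all_semigroups T)
    (h : {multiplicative S -> T}) (f : A -> S) :
  h (w S IS (fun i => t i S IS f)) = w T IT (fun i => t i T IT (h \o f)).
Proof.
rewrite (pw_natural w IS IT); congr (pw_eval w _ _).
by apply/funext => i /=; rewrite (pw_natural (t i) IS IT).
Qed.

Definition pw_op : pseudoword A := FreeProV pw_op_natural.

End Interpretation.

Definition mul_pw : pseudoword 'I_2 := pw_gen _ ord0 * pw_gen _ ord_max.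

Section Omega.

(* x ^ (n + 1) *)
Definition spow (S : semigroupType) (x : S) (n : nat) : S := iter n (mul x) x.

Lemma spowD (S : semigroupType) (x : S) m n :
  spow x m * spow x n = spow x (m + n).+1.
Proof. by elim: m => [|m IH] //=; rewrite -mulgA IH. Qed.

Lemma spow_natural (S T : semigroupType) (h : {multiplicative S -> T}) x n :
  h (spow x n) = spow (h x) n.
Proof. by elim: n => [|n IH] //=; rewrite gmulfM IH. Qed.

Lemma spow_idem (S : semigroupType) (x : S) n :
  x * x = x -> spow x n = x.
Proof. by move=> xx; elim: n => [|n IH] //=; rewrite IH. Qed.

Lemma spowM (S : semigroupType) (x : S) m n :
  spow (spow x m) n = spow x (m.+1 * n.+1).-1.
Proof.
elim: n => [|n IH]; first by rewrite muln1.
by rewrite [LHS]/= IH spowD; apply: (congr1 (spow x)); lia.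
Qed.

Lemma idem_power_exists (S : finSemigroupType) (x : S) :
  exists n, spow x n * spow x n == spow x n.
Proof.
pose g (i : 'I_#|S|.+1) := spow x i.
have /injectivePn [i [j ij gij]] : ~~ injectiveb g.
  by apply/negP => /injectiveP /leq_card; rewrite card_ord ltnn.
wlog lij : i j ij gij / (i < j)%N => [W|].
  case: (ltngtP i j) => [/W|/W|/val_inj E]; first by apply.
  - by apply => //; rewrite eq_sym.
  - by rewrite E eqxx in ij.
have per m : spow x (i + m) = spow x (j + m).
  case: m => [|m]; first by rewrite !addn0.
  by rewrite !addnS -!spowD; congr (_ * _).
have perk k m : (i <= m)%N -> spow x (m + k * (j - i)) = spow x m.
  move=> im; elim: k => [|k IH]; first by rewrite addn0.
  rewrite -IH mulSn.
  have -> : (m + (j - i + k * (j - i)) = j + (m - i + k * (j - i)))%N by lia.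
  by rewrite -per; apply: (congr1 (spow x)); lia.
exists (i.+1 * (j - i)).-1.
have d0 : (0 < j - i)%N by lia.
have le : (i <= (i.+1 * (j - i)).-1)%N by nia.
rewrite spowD -[X in _ == X](perk i.+1 _ le); apply/eqP; apply: (congr1 (spow x)).
by nia.
Qed.

Definition omega_pow (S : finSemigroupType) (x : S) : S :=
  spow x (ex_minn (idem_power_exists x)).

Lemma omega_pow_idem (S : finSemigroupType) (x : S) :
  omega_pow x * omega_pow x = omega_pow x.
Proof. by rewrite /omega_pow; case: ex_minnP => n /eqP. Qed.

Lemma omega_pow_unique (S : finSemigroupType) (x : S) n :
  spow x n * spow x n = spow x n -> spow x n = omega_pow x.
Proof.
move=> xn; have := omega_pow_idem x; rewrite /omega_pow.
set m := ex_minn _ => xm.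
by rewrite -(spow_idem m xn) -(spow_idem n xm) !spowM mulnC.
Qed.

Lemma omega_pow_natural (S T : finSemigroupType) (h : {multiplicative S -> T})
    (x : S) : h (omega_pow x) = omega_pow (h x).
Proof.
rewrite /omega_pow spow_natural; apply: omega_pow_unique.
by rewrite -spow_natural -gmulfM; congr (h _); exact: omega_pow_idem.
Qed.

Definition omega_pw : pseudoword 'I_1 :=
  @FreeProV all_semigroups 'I_1 (fun S _ f => omega_pow (f ord0))
    (fun S T _ _ h f => omega_pow_natural h (f ord0)).

End Omega.

Definition signature := forall n : nat, set (pseudoword 'I_n).

Definition implicit_signature (sigma : signature) : Prop := sigma 2 mul_pw.

Inductive omega_signature : signature :=
  OmegaSignature : omega_signature omega_pw.

Definition add_omega (sigma : signature) : signature :=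
  fun n => sigma n `|` @omega_signature n.

Inductive sigma_subalgebra (sigma : signature) (A : finType) : set (pseudoword A) :=
| SigmaGen a : sigma_subalgebra sigma (pw_gen _ a)
| SigmaOp n (w : pseudoword 'I_n) (t : 'I_n -> pseudoword A) :
    sigma n w -> (forall i, sigma_subalgebra sigma (t i)) ->
    sigma_subalgebra sigma (pw_op w t).

Definition onto_continuous (A : finType) (S : finSemigroupType)
    (phi : {multiplicative pseudoword A -> S}) : Prop :=
  continuous (phi : pseudoword A -> discrete_topology S) /\
  forall s, exists w, phi w = s.

Definition idempotent_pointlike (V : semigroup_class) (S : finSemigroupType)
    (P : set S) : Prop :=
  P !=set0 /\
  forall (A : finType) (phi : {multiplicative pseudoword A -> S}),
    onto_continuous phi ->
    exists P' : set (pseudoword A), phi @` P' = P /\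
      exists e : freeProV V A, e * e = e /\ @pw_proj V A @` P' = [set e].

Record digraph := Digraph {
  vertex : finType;
  edge : finType;
  source : edge -> vertex;
  target : edge -> vertex
}.

Definition graph_solution (V : semigroup_class) (Gamma : digraph)
    (A : finType) (S : finSemigroupType)
    (phi : {multiplicative pseudoword A -> S})
    (psi : vertex Gamma + edge Gamma -> S)
    (gamma : vertex Gamma + edge Gamma -> pseudoword A) : Prop :=
  (forall x, phi (gamma x) = psi x) /\
  forall y : edge Gamma,
    pw_proj V (gamma (inl (source y)) * gamma (inr y)) =
    pw_proj V (gamma (inl (target y))).

Definition graph_reducible (sigma : signature) (V : semigroup_class) : Prop :=
  forall (Gamma : digraph) (A : finType) (S : finSemigroupType)
    (phi : {multiplicative pseudoword A -> S})
    (psi : vertex Gamma + edge Gamma -> S),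
    onto_continuous phi ->
    (exists gamma, graph_solution V phi psi gamma) ->
    exists gamma, graph_solution V phi psi gamma /\
      forall x, sigma_subalgebra sigma (gamma x).

(* Main.v *)
(* Write V = DO /\ Hbar. In a semigroup of V, an idempotent e = x^omega lies
   J-below every product t of letters of x, and t |-> e t e is a homomorphism
   to the maximal subgroup at e; hence, over V, x^omega t y^omega depends only
   on the value of t over H, as soon as x and y have the same content,
   containing that of t.

   A tuple (u_i) of pseudowords that is constant over V is factored at the
   letter whose first occurrence comes last; this factorization is unique over
   V, because V is closed under the semigroup [occurrence] that computes it.
   Iterating it, either the remainder loses a letter, and one concludes by
   induction on the content, or a prefix repeats its value in the given finite
   quotient, which allows inserting an omega power; dually for suffixes. This
   leaves finitely many factors on which only equality over H is required,
   a condition which together with the idempotency of their product is a graph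
   system on a cycle. If the u_i are V-regular, the factorization never stops,
   so that the replacement is regular over V, and idempotent since it is so
   over H. *)
Require Import Defs.
From HB Require Import structures.
From mathcomp Require Import all_boot.
From mathcomp Require Import boolp classical_sets functions topology.

Set Implicit Arguments.
Unset Strict Implicit.
Unset Printing Implicit Defensive.

Local Open Scope classical_set_scope.
Local Open Scope group_scope.

(** * Finite semigroups in DO *)

Section AdjoinUnit.
Variable S : semigroupType.

(** [None] plays the unit of S^1, so that an empty prefix or suffix is an ordinary factor. *)
Definition omul (x y : option S) : option S :=
  match x, y with
  | None, _ => y
  | Some a, Some b => Some (a * b)
  | Some a, None => Some a
  end.

Lemma omulA : associative omul.
Proof. by case=> [a|] [b|] [c|] //=; rewrite mulgA. Qed.

HB.instance Definition _ := hasMul.Build (option S) omul.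
HB.instance Definition _ := Magma_isSemigroup.Build (option S) omulA.

Lemma omulE (a b : S) : Some a * Some b = Some (a * b). Proof. by []. Qed.
Lemma omulr1 (x : option S) : x * None = x. Proof. by case: x. Qed.

(** Products are kept associated to the left; [cat2] and [cat3] rewrite inside them, [w] standing
    for all that comes before. *)
Lemma cat2 (b c r : S) : b * c = r -> forall w, w * b * c = w * r.
Proof. by move=> <- w; rewrite mulgA. Qed.

Lemma cat3 (a b c r : S) : a * b * c = r -> forall w, w * a * b * c = w * r.
Proof. by move=> <- w; rewrite !mulgA. Qed.

End AdjoinUnit.

Section GreenJ.
Variable S : finSemigroupType.
Implicit Types x y z e f : S.

Lemma leJ_refl x : leJ x x.
Proof. by apply: Or41. Qed.

Lemma leJP x y : leJ x y <-> exists l r : option S, Some x = l * Some y * r.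
Proof.
split=> [[->|[a ->]|[a ->]|[a [b ->]]]|[[a|] [[b|] [->]]]].
- by exists None, None.
- by exists (Some a), None.
- by exists None, (Some a).
- by exists (Some a), (Some b).
- by apply: Or44; exists a, b.
- by apply: Or42; exists a.
- by apply: Or43; exists b.
- exact: leJ_refl.
Qed.

Lemma leJ_mull x y : leJ (x * y) y.
Proof. by apply: Or42; exists x. Qed.

Lemma leJ_mulr x y : leJ (x * y) x.
Proof. by apply: Or43; exists y. Qed.

Lemma leJ_mid x y z : leJ (x * y * z) y.
Proof. by apply: Or44; exists x, z. Qed.

Lemma leJ_trans y x z : leJ x y -> leJ y z -> leJ x z.
Proof.
move=> /leJP[l [r E]] /leJP[l' [r' E']]; apply/leJP.
by exists (l * l'), (r' * r); rewrite E E' !mulgA.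
Qed.

Lemma leJ_idem e x : e * e = e -> leJ e x -> exists p q, e = p * x * q.
Proof.
move=> ee [E|[a E]|[b E]|[a [b E]]].
- by exists e, e; rewrite -E !ee.
- by exists a, e; rewrite -E ee.
- by exists e, b; rewrite -mulgA -E ee.
- by exists a, b.
Qed.

Lemma spow_comm x n : spow x n * x = x * spow x n.
Proof. by rewrite -[x]/(spow x 0) !spowD addn0. Qed.

Lemma spow_mull x y n : exists z, spow (x * y) n = x * z.
Proof. by case: n => [|n]; [exists y|exists (y * spow (x * y) n); rewrite mulgA]. Qed.

Lemma spow_mulr x y n : exists z, spow (x * y) n = z * y.
Proof.
case: n => [|n]; first by exists x.
by exists (spow (x * y) n * x); rewrite /= -spow_comm mulgA.
Qed.

Lemma spow_shift x y z n : z = x * z * y -> z = spow x n * z * spow y n.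
Proof.
move=> E; elim: n => // n IH.
by rewrite /= -spow_comm !mulgA -(mulgA _ x) -(mulgA _ (x * z)) -E.
Qed.

Lemma omega_spow x : exists n, omega_pow x = spow x n.
Proof. by rewrite /omega_pow; case: ex_minnP => n *; exists n. Qed.

Lemma omega_pow_id x : x * x = x -> omega_pow x = x.
Proof. by move=> xx; case: (omega_spow x) => n ->; exact: spow_idem. Qed.

Lemma omega_pow_inv x :
  exists y, x * y = omega_pow x /\ y * x = omega_pow x.
Proof.
case: (omega_spow x) (omega_pow_idem x) => n -> nn.
(* Squaring the idempotent power leaves a nonempty cofactor of [x] even when this power is [x]
   itself. *)
rewrite -nn; case: n {nn} => [|n]; first by exists x.
by exists (spow x n * spow x n.+1); rewrite mulgA -[spow x n.+1 * _ in RHS]/(x * _ * _); split;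
  [|rewrite -mulgA spow_comm mulgA spow_comm -!mulgA].
Qed.

End GreenJ.

Lemma leJ_hom (S T : finSemigroupType) (h : {multiplicative S -> T}) (x y : S) :
  leJ x y -> leJ (h x) (h y).
Proof.
case=> [->|[a ->]|[a ->]|[a [b ->]]]; rewrite ?gmulfM.
- exact: leJ_refl.
- exact: leJ_mull.
- exact: leJ_mulr.
- exact: leJ_mid.
Qed.

(** A form of DO that transfers easily to new semigroups, as it involves only J-equivalent
    idempotents. The equivalence is [DO_orthodoxJ] and [orthodoxJ_DO]. *)
Definition orthodoxJ (S : finSemigroupType) : Prop :=
  forall e f : S, e * e = e -> f * f = f -> leJ e f -> leJ f e -> e * f * e = e.

Section OrthodoxJ.
Variables (S : finSemigroupType) (OS : orthodoxJ S).
Implicit Types x y z : S.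

Section AboveIdempotent.
Variables (e : S) (ee : e * e = e).

(** From p x q = e and p' y q' = e arise idempotents j, ending in x, and i, beginning with y, both
    J-equivalent to e. Then j = j i j has x y as a factor. *)
Lemma aboveM x y : leJ e x -> leJ e y -> leJ e (x * y).
Proof.
move=> /(leJ_idem ee)[p [q E]] /(leJ_idem ee)[p' [q' E']].
pose j := q * e * p * x; pose i := y * q' * e * p'.
have E1 := esym E; have E1' := esym E'.
have pjq : p * x * j * q = e.
  by rewrite /j !mulgA E1 ee (cat3 E1) ee.
have piq : p' * i * y * q' = e.
  by rewrite /i !mulgA E1' ee (cat3 E1') ee.
have jj : j * j = j by rewrite /j !mulgA (cat3 E1) (cat2 ee) (cat2 ee).
have ii : i * i = i by rewrite /i !mulgA (cat3 E1') (cat2 ee) (cat2 ee).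
have ej : leJ e j by rewrite -pjq; exact: leJ_mid.
have ei : leJ e i.
  by rewrite -piq -(mulgA _ y); exact: leJ_mid.
have je : leJ j e by rewrite /j -mulgA; exact: leJ_mid.
have ie : leJ i e.
  rewrite /i -(mulgA _ e p').
  by apply: (@leJ_trans _ (e * p')); [exact: leJ_mull|exact: leJ_mulr].
have jij : j * i * j = j.
  by apply: OS => //; [exact: leJ_trans je ei|exact: leJ_trans ie ej].
apply: leJ_trans ej _; rewrite -jij /j /i.
have -> : q * e * p * x * (y * q' * e * p') * (q * e * p * x) =
  q * e * p * (x * y) * (q' * e * p' * (q * e * p * x)) by rewrite !mulgA.
exact: leJ_mid.
Qed.

Lemma above_spow x n : leJ e x -> leJ e (spow x n).
Proof. by move=> ex; elim: n => // n IH; exact: aboveM. Qed.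

Lemma above_omega x : leJ e x -> leJ e (omega_pow x).
Proof. by case: (omega_spow x) => n -> /above_spow. Qed.

(** The product v w is again an idempotent of the J-class, whence u v w u = u; writing w = w u w
    gives u v w = (u v w u) w = u w. *)
Lemma rect_mul u v w : u * u = u -> v * v = v -> w * w = w ->
  leJ e u -> leJ e v -> leJ e w -> leJ u e -> leJ v e -> leJ w e ->
  u * v * w = u * w.
Proof.
move=> uu vv ww eu ev ew ue ve we.
have uvu : u * v * u = u by apply: OS => //; [exact: leJ_trans ue ev|exact: leJ_trans ve eu].
have uwu : u * w * u = u by apply: OS => //; [exact: leJ_trans ue ew|exact: leJ_trans we eu].
have wuw : w * u * w = w by apply: OS => //; [exact: leJ_trans we eu|exact: leJ_trans ue ew].
have vwi : v * w * (v * w) = v * w.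
  rewrite mulgA (_ : v * w * v = v) //.
  by apply: OS => //; [exact: leJ_trans ve ew|exact: leJ_trans we ev].
have := OS uu vwi; rewrite -{1 2}wuw !mulgA => H.
have H' : u * v * w * u = u.
  rewrite -[u * v * w]mulgA; apply: OS => //; first exact: leJ_trans ue (aboveM ev ew).
  by apply: leJ_trans (leJ_mulr _ _) (leJ_trans ve eu).
by rewrite -{1}wuw !mulgA H'.
Qed.

(* Stability of finite semigroups, here read off powers of the multipliers
   witnessing the J-equivalence. *)
Lemma Jidem_unit z : leJ e z -> leJ z e ->
  exists u, [/\ u * u = u, leJ e u, leJ u e, u * z = z & z * u = z].
Proof.
move=> ez ze; have [c [d E]] := leJ_idem ee ez.
have [a [b Z]] : exists a b, z = a * e * b.
  case: ze => [->|[a ->]|[b ->]|[a [b ->]]]; last by exists a, b.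
  - by exists e, e; rewrite !ee.
  - by exists a, e; rewrite -mulgA ee.
  - by exists e, b; rewrite ee.
have lz : z = (a * c) * z * (d * b) by rewrite {1}Z {1}E !mulgA.
have omegaz : z = omega_pow (a * c) * z /\ z = z * omega_pow (d * b).
  case: (omega_spow (a * c)) (omega_pow_idem (a * c)) => m -> mm.
  case: (omega_spow (d * b)) (omega_pow_idem (d * b)) => k -> kk.
  have zm := spow_shift m lz; have zk := spow_shift k lz.
  split; first by rewrite {2}zm !mulgA mm -zm.
  by rewrite {2}zk -mulgA kk -zk.
have [b' rz] : exists b', z = z * d * b'.
  have [n En] := omega_spow (d * b); have [y Ey] := spow_mull d b n.
  by exists y; rewrite -mulgA -Ey -En; case: omegaz.
have [a' lz'] : exists a', z = a' * c * z.
  have [n En] := omega_spow (a * c); have [y Ey] := spow_mulr a c n.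
  by exists y; rewrite -Ey -En; case: omegaz.
have E1 := esym E.
have zde : z * d * e = z * d.
  have zd : z * d = a' * e by rewrite {1}lz' E !mulgA.
  by rewrite zd -mulgA ee.
(* The idempotent [i] fixes [z] on the left. With u the omega power of z, i u = u and i u i = i give
   u i = i, hence u z = z; then z u = z because z commutes with its powers. *)
pose i := z * d * c.
have ii : i * i = i by rewrite /i !mulgA (cat3 E1) zde.
have iz : i * z = z.
  by rewrite {1}rz /i !mulgA (cat3 E1) zde -rz.
have ie : leJ i e.
  by apply: leJ_trans ze; rewrite /i -mulgA; exact: leJ_mulr.
have ei : leJ e i.
  by have := leJ_mid c i (z * d); rewrite mulgA (cat2 iz) -E.
pose u := omega_pow z.
have uu : u * u = u := omega_pow_idem z.
have eu : leJ e u := above_omega ez.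
have [y [zy yz]] := omega_pow_inv z.
have ue : leJ u e by rewrite /u -zy; exact: leJ_trans (leJ_mulr _ _) ze.
have iu : i * u = u by rewrite /u -zy mulgA iz.
have ui : u * i = i * u * i by rewrite iu.
rewrite (OS ii uu (leJ_trans ie eu) (leJ_trans ue ei)) in ui.
have uz : u * z = z by rewrite -{1}iz mulgA ui.
exists u; split=> //.
by rewrite -{2}uz /u -yz -mulgA (mulgA z) zy -yz -mulgA; congr (_ * _);
   rewrite /u zy.
Qed.

End AboveIdempotent.
End OrthodoxJ.

(** * Subsemigroups and maximal subgroups *)

Section Subsemigroup.
Variables (S : finSemigroupType) (P : set S).
Hypothesis PM : forall x y, P x -> P y -> P (x * y).

Definition subsg of (forall x y, P x -> P y -> P (x * y)) := {x : S | `[< P x >]}.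
Local Notation T := (subsg PM).

HB.instance Definition _ := Finite.on T.

Lemma subsg_mulP (x y : T) : `[< P (sval x * sval y) >].
Proof. by case: x y => x Px [y Py]; apply/asboolP/PM; exact/asboolP. Qed.

Definition subsg_mul (x y : T) : T := Sub (sval x * sval y) (subsg_mulP x y).

Lemma subsg_mulA : associative subsg_mul.
Proof. by move=> x y z; apply: val_inj; rewrite /= mulgA. Qed.

HB.instance Definition _ := hasMul.Build T subsg_mul.
HB.instance Definition _ := Magma_isSemigroup.Build T subsg_mulA.

Definition subsg_val (x : T) : S := sval x.

Lemma subsg_valM : {morph subsg_val : x y / x * y >-> x * y}.
Proof. by []. Qed.

HB.instance Definition _ := isMultiplicative.Build T S subsg_val subsg_valM.

Definition subsg_in x (Px : P x) : T := Sub x (asboolT Px).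

Lemma subsg_val_inj : injective subsg_val.
Proof. exact: val_inj. Qed.

Lemma subsg_valP (x : T) : P (subsg_val x).
Proof. by case: x => x /= /asboolP. Qed.

End Subsemigroup.

Definition hom_of (S T : magmaType) (f : S -> T) (fM : {morph f : x y / x * y >-> x * y}) :
  {multiplicative S -> T} := HB.pack f (isMultiplicative.Build S T f fM).

Section Units.
Variables (S : finSemigroupType) (e : S).

(** For an idempotent [e], the group of units of the local monoid eSe, that is, the maximal subgroup
    at [e]. *)
Definition unit_at : set S := [set z | [/\ e * z = z, z * e = z &
  exists y, [/\ e * y = y, y * e = y, z * y = e & y * z = e]]].

Lemma unit_atM x y : unit_at x -> unit_at y -> unit_at (x * y).
Proof.
move=> [ex xe [x' [ex' xe' xx' x'x]]] [ey ye [y' [ey' ye' yy' y'y]]]; split.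
- by rewrite mulgA ex.
- by rewrite -mulgA ye.
exists (y' * x'); split; rewrite ?mulgA.
- by rewrite ey'.
- by rewrite -mulgA xe'.
- by rewrite (cat2 yy') xe xx'.
- by rewrite (cat2 x'x) ye' y'y.
Qed.

Definition units : finSemigroupType := subsg unit_atM.

Definition units_val : {multiplicative units -> S} := @subsg_val S unit_at unit_atM.

Lemma units_group : e * e = e -> is_group units.
Proof.
move=> ee; have ue : unit_at e by split=> //; exists e.
exists (subsg_in unit_atM ue); split=> x.
  by case: (subsg_valP x) => ex xe _; split; apply: subsg_val_inj; rewrite gmulfM.
case: (subsg_valP x) => ex xe [y [ey ye xy yx]].
have uy : unit_at y by split=> //; exists (subsg_val x).
by exists (subsg_in unit_atM uy); split; apply: subsg_val_inj; rewrite gmulfM.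
Qed.

End Units.

Lemma group_idem (G : finSemigroupType) (g : G) : is_group G -> g * g = g ->
  forall x, g * x = x /\ x * g = x.
Proof.
case=> e [eu ei] gg; have [y [yg gy]] := ei g.
have -> : g = e by rewrite -[g](proj1 (eu g)) -[X in X * _]yg -mulgA gg.
exact: eu.
Qed.

(** An idempotent of a product of a rectangular band and a group has the unit as its group
    component, so the law comes from the band. *)
Lemma DO_orthodoxJ (S : finSemigroupType) : DO S -> orthodoxJ S.
Proof.
move=> DOS e f ee ff ef fe.
have [|B [G [rB [gG [h [hi rh]]]]]] := DOS e; first by exists e; rewrite !ee.
have [[b g] _ he] : range h e by rewrite rh; split; exact: leJ_refl.
have [[b' g'] _ hf] : range h f by rewrite rh; split.
have ggU (x : B) (y : G) : h (x, y) * h (x, y) = h (x, y) ->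
    forall z, y * z = z /\ z * y = z.
  by rewrite -gmulfM => /hi [_ yy]; exact: group_idem.
rewrite -he -hf -!gmulfM; congr (h _); congr pair; first by have [_ ->] := rB b b'.
move: ee ff; rewrite -he -hf => /ggU Ug /ggU Ug'.
by rewrite /= (proj1 (Ug _)) (proj1 (Ug' _)).
Qed.

Section GroupPart.
Variables (S : finSemigroupType) (OS : orthodoxJ S) (e : S) (ee : e * e = e).

(** The omega power of z = e x e is J-equivalent to e and fixed by e on both sides, so it equals e
    by orthodoxy; the cofactor of z in it yields the inverse. *)
Lemma unit_corner x : leJ e x -> unit_at e (e * x * e).
Proof.
move=> ex; pose z := e * x * e.
have ez : e * z = z by rewrite /z !mulgA ee.
have ze : z * e = z by rewrite /z (cat2 ee).
have Kz : leJ e z.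
  by apply: (aboveM OS) => //; [apply: (aboveM OS) => //|]; exact: leJ_refl.
have [y [zy yz]] := omega_pow_inv z; pose u := omega_pow z.
have eu : e * u = u by rewrite /u -zy mulgA ez.
have ue : u * e = u by rewrite /u -yz -mulgA ze.
have uE : u = e.
  rewrite -[LHS]ue -{1}eu; apply: OS => //; first exact: omega_pow_idem.
  - exact: above_omega.
  - by rewrite -eu; exact: leJ_mulr.
split=> //; exists (e * y * e); split.
- by rewrite !mulgA ee.
- by rewrite (cat2 ee).
- by rewrite -/z !mulgA ze zy -/u uE ee.
- by rewrite -/z -mulgA ez -mulgA yz -/u uE ee.
Qed.

(** [Jidem_unit] supplies idempotents u, v in the J-class of e with e x = e x u and y e = v y e.
    Between them the middle e disappears, since u e v = u v. *)
Lemma corner_mul x y : leJ e x -> leJ e y ->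
  e * x * e * (e * y * e) = e * (x * y) * e.
Proof.
move=> ex ey.
have e1 := leJ_refl e.
have [u [uu eu ue _ exu]] : exists u, [/\ u * u = u, leJ e u, leJ u e,
    u * (e * x) = e * x & e * x * u = e * x].
  by apply: (Jidem_unit OS ee); [exact: (aboveM OS ee e1 ex)|exact: leJ_mulr].
have [v [vv ev ve vye _]] : exists u, [/\ u * u = u, leJ e u, leJ u e,
    u * (y * e) = y * e & y * e * u = y * e].
  by apply: (Jidem_unit OS ee); [exact: (aboveM OS ee ey e1)|exact: leJ_mull].
have R : u * e * v = u * v by exact: (rect_mul OS ee).
have -> : e * x * e * (e * y * e) = e * x * u * e * (v * (y * e)).
  by rewrite exu vye !mulgA (cat2 ee).
have -> : e * (x * y) * e = e * x * u * (v * (y * e)) by rewrite exu vye !mulgA.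
by rewrite !mulgA (cat3 R) !mulgA.
Qed.

Lemma idem_absorb f x : f * f = f -> leJ e f -> leJ f e -> leJ e x ->
  e * x * f = e * x * e * f.
Proof.
move=> ff ef fe ex.
have [u [uu eu ue _ exu]] : exists u, [/\ u * u = u, leJ e u, leJ u e,
    u * (e * x) = e * x & e * x * u = e * x].
  apply: (Jidem_unit OS ee); first by apply: (aboveM OS ee) => //; exact: leJ_refl.
  exact: leJ_mulr.
have R : u * e * f = u * f by apply: (rect_mul OS ee) => //; exact: leJ_refl.
by rewrite -exu (cat3 R) mulgA.
Qed.

(** With u the idempotent fixing w on both sides, u = u e u gives w = u (e w e) u = u e u = u. *)
Lemma corner_idem w : leJ e w -> leJ w e -> e * w * e = e -> w * w = w.
Proof.
move=> ew we ewe; have [u [uu eu ue uw wu]] := Jidem_unit OS ee ew we.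
have ueu : u * e * u = u by exact: OS.
suff -> : w = u by [].
have uwu : u * w * u = w by rewrite uw wu.
have <- : u * e * u * w * (u * e * u) = w by rewrite ueu.
by rewrite !mulgA (cat3 uwu) (cat3 ewe).
Qed.

End GroupPart.

(** The J-class is the product of the band of its idempotents and the maximal subgroup at e = x y,
    through (b, g) |-> b g b. An element z comes from (u, e z e), where u is the idempotent fixing z
    on both sides. *)
Lemma orthodoxJ_DO (S : finSemigroupType) : orthodoxJ S -> DO S.
Proof.
move=> OS x [y xyx]; pose e := x * y.
have ee : e * e = e by rewrite /e mulgA xyx.
have ex : leJ e x by exact: leJ_mulr.
have xe : leJ x e by rewrite -[X in leJ X _]xyx; exact: leJ_mulr.
clearbody e.
pose E : set S := [set b | [/\ b * b = b, leJ e b & leJ b e]].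
have EM b c : E b -> E c -> E (b * c).
  move=> [bb eb be] [cc ec ce]; split.
  - rewrite mulgA (_ : b * c * b = b) //.
    by apply: OS => //; [exact: leJ_trans be ec|exact: leJ_trans ce eb].
  - exact: aboveM.
  - exact: leJ_trans (leJ_mulr _ _) be.
have E_e : E e by split=> //; exact: leJ_refl.
have rect a b c : E a -> E b -> E c -> a * b * c = a * c.
  by move=> [? ? ?] [? ? ?] [? ? ?]; exact: (rect_mul OS ee).
pose B : finSemigroupType := subsg EM.
have BP (b : B) : E (subsg_val b) := subsg_valP b.
have GP (g : units e) := subsg_valP g.
exists B, (units e); split; last split; [|exact: units_group|].
  move=> b c; split; apply: subsg_val_inj; rewrite !gmulfM; first by case: (BP b).
  by rewrite (rect _ _ _ (BP b) (BP c) (BP b)); case: (BP b).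
pose m (p : B * units e) : S := subsg_val p.1 * subsg_val p.2 * subsg_val p.1.
have mM : {morph m : p q / p * q >-> p * q}.
  move=> [b g] [c k].
  change (subsg_val b * subsg_val c * (subsg_val g * subsg_val k) * (subsg_val b * subsg_val c) =
    subsg_val b * subsg_val g * subsg_val b * (subsg_val c * subsg_val k * subsg_val c)).
  move: (BP b) (BP c) (GP g) (GP k).
  move: (subsg_val b) (subsg_val c) (subsg_val g) (subsg_val k).
  move=> {}b {}c {}g {}k Eb Ec [eg ge _] [ek ke _].
  have -> : b * c * (g * k) * (b * c) = b * c * e * g * k * (e * b * c).
    by rewrite !mulgA (cat2 eg) (cat2 ke).
  rewrite (rect b c e) // (rect e b c) // !mulgA (cat2 eg) (cat2 ke).
  have -> : b * g * b * c * k * c = b * g * e * b * c * e * k * c.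
    by rewrite (cat2 ge) (cat2 ek).
  by rewrite (cat3 (rect _ _ _ E_e Eb Ec)) mulgA (cat3 (rect _ _ _ E_e Ec E_e)) ee (cat2 ge).
exists (hom_of mM); split.
  move=> [b g] [c k]; rewrite /= /m /= => bg.
  suff [? ?] : subsg_val b = subsg_val c /\ subsg_val g = subsg_val k.
    by congr pair; apply: subsg_val_inj.
  move: bg (BP b) (BP c) (GP g) (GP k).
  move: (subsg_val b) (subsg_val c) (subsg_val g) (subsg_val k).
  move=> {}b {}c {}g {}k bg Eb Ec [eg ge [g' [eg' ge' gg' g'g]]] [ek ke _].
  have ebe d : E d -> e * d * e = e by move=> Ed; rewrite rect.
  have corner d z : E d -> e * z = z -> z * e = z -> e * (d * z * d) * e = z.
    move=> Ed ez ze.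
    have -> : e * (d * z * d) * e = e * d * e * z * e * d * e.
      by rewrite !mulgA (cat2 ez) (cat2 ze).
    by rewrite (ebe _ Ed) ez (cat3 (ebe _ Ed)) ze.
  (* Multiplying by [e] on both sides recovers the group component, since e d e = e for each
     idempotent d of the class. *)
  have gk : g = k by rewrite -(corner _ _ Eb eg ge) bg corner.
  split=> //; subst k.
  have Eb2 : b * b = b by case: Eb.
  have Ec2 : c * c = c by case: Ec.
  have beb d : E d -> d * e * d = d by move=> Ed; rewrite rect //; case: Ed.
  have inv d t z : E d -> e * t = t -> z * e = z -> z * t = e ->
      d * z * d * (d * t * d) = d.
    move=> Ed et ze zt; have dd : d * d = d by case: Ed.
    have -> : d * z * d * (d * t * d) = d * z * e * d * e * t * d.
      by rewrite !mulgA (cat2 dd) (cat2 ze) (cat2 et).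
    by rewrite (cat3 (ebe _ Ed)) (cat2 ze) (cat2 zt) beb.
  (* Inverses of the common element b g b = c g c show that [b] begins with [c] and that [c] ends
     with [b], hence c b = b and c b = c. *)
  have hb : c * g * c * (b * g' * b) = b by rewrite -bg inv.
  have hc : c * g' * c * (b * g * b) = c by rewrite bg inv.
  have cb : c * b = b by rewrite -{1}hb !mulgA Ec2 -[RHS]hb !mulgA.
  by rewrite -cb -{1}hc -mulgA -(mulgA _ b b) Eb2.
rewrite eqEsubset; split=> [_ [[b g] _ <-]|z [xz zx]] /=.
  rewrite /m /=; case: (BP b) => bb eb be; case: (GP g) => eg ge [g' [_ _ gg' _]].
  have Kg : leJ e (subsg_val g) by have := leJ_mulr (subsg_val g) g'; rewrite gg'.
  split; last first.
    apply: leJ_trans ex; apply: leJ_trans (leJ_mulr _ _) _.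
    exact: leJ_trans (leJ_mulr _ _) be.
  by apply: leJ_trans xe _; apply: aboveM => //; exact: aboveM.
have ez : leJ e z := leJ_trans ex xz.
have ze : leJ z e := leJ_trans zx xe.
have [u [uu eu ue uz zu]] := Jidem_unit OS ee ez ze.
have Eu : E u by [].
exists (subsg_in EM Eu, subsg_in (@unit_atM S e) (unit_corner OS ee ez)) => //.
have ueu : u * e * u = u by rewrite rect.
change (u * (e * z * e) * u = z).
have <- : u * e * u * z * u * e * u = u * (e * z * e) * u.
  by rewrite !mulgA (cat2 uz) (cat2 zu).
by rewrite ueu (cat3 ueu) uz zu.
Qed.

(** * Opposites and marked first occurrences *)

Definition opposite (S : Type) : Type := S.

Section Opposite.
Variable S : finSemigroupType.
Local Notation T := (opposite S).

HB.instance Definition _ := Finite.copy T S.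

Definition opposite_mul (x y : T) : T := (y : S) * (x : S).

Lemma opposite_mulA : associative opposite_mul.
Proof. by move=> x y z; rewrite /opposite_mul mulgA. Qed.

HB.instance Definition _ := hasMul.Build T opposite_mul.
HB.instance Definition _ := Magma_isSemigroup.Build T opposite_mulA.

Lemma leJ_opposite (x y : S) : leJ (x : T) (y : T) -> leJ x y.
Proof.
case=> [->|[a ->]|[a ->]|[a [b ->]]].
- exact: leJ_refl.
- exact: leJ_mulr.
- exact: leJ_mull.
- by rewrite [_ * _]mulgA; exact: leJ_mid.
Qed.

Lemma orthodoxJ_opposite : orthodoxJ S -> orthodoxJ T.
Proof.
move=> OS e f ee ff /leJ_opposite ef /leJ_opposite fe.
exact: etrans (@mulgA S e f e) (OS e f ee ff ef fe).
Qed.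

End Opposite.

(* The pair [inr (x, y)] represents the value of a word with a marked first
   occurrence of a letter of value [c], [x] and [y] being the values of the
   parts before and after it; [inl s] is the value of a word without this
   letter. *)
Definition occurrence (S : finSemigroupType) of S : Type :=
  (S + option S * option S)%type.

Section Occurrence.
Variables (S : finSemigroupType) (c : S).
Local Notation T := (occurrence c).

HB.instance Definition _ := Finite.copy T (S + option S * option S)%type.

Definition occ_mul (u v : T) : T :=
  match u, v with
  | inl s, inl t => inl (s * t)
  | inl s, inr (x, y) => inr (Some s * x, y)
  | inr (x, y), inl t => inr (x, y * Some t)
  | inr (x, y), inr (x', y') => inr (x, y * x' * Some c * y')
  end.

Lemma occ_mulA : associative occ_mul.
Proof.
by move=> [s|[x y]] [s'|[x' y']] [s''|[x'' y'']] //=; rewrite -?omulE !mulgA.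
Qed.

HB.instance Definition _ := hasMul.Build T occ_mul.
HB.instance Definition _ := Magma_isSemigroup.Build T occ_mulA.

Definition occ_val (u : T) : S :=
  match u with
  | inl s => s
  | inr (x, y) => odflt c (x * Some c * y)
  end.

Lemma occ_valE (u : T) : Some (occ_val u) =
  match u with inl s => Some s | inr (x, y) => x * Some c * y end.
Proof. by case: u => [s|[[x|] [y|]]]. Qed.

Lemma occ_valM : {morph occ_val : u v / u * v >-> u * v}.
Proof.
move=> u v; apply: Some_inj; rewrite -omulE !occ_valE -[u * v]/(occ_mul u v).
by case: u v => [s|[x y]] [s'|[x' y']] //; rewrite /occ_mul !mulgA.
Qed.

Definition occ_hom : {multiplicative T -> S} := hom_of occ_valM.

Definition occ_found (u : T) : bool := if u is inr _ then true else false.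

Lemma occ_foundM (u v : T) : occ_found (u * v) = occ_found u || occ_found v.
Proof. by case: u v => [s|[x y]] [s'|[x' y']]. Qed.

Lemma leJ_occ_found (u v : T) : leJ u v -> occ_found v -> occ_found u.
Proof.
by case=> [->//|[a ->]|[a ->]|[a [b ->]]]; rewrite !occ_foundM => ->; rewrite ?orbT.
Qed.

Lemma leJ_occ_inl (s t : S) : leJ (inl s : T) (inl t) -> leJ s t.
Proof. by move/(leJ_hom occ_hom). Qed.

Lemma occ_mul_inr (x y : option S) (v : T) : occ_found v ->
  (inr (x, y) : T) * v = inr (x, y * Some (occ_val v)).
Proof. by move: v => [//|[x' y']] _; rewrite occ_valE !mulgA. Qed.

(** J-equivalent elements are both marked or both unmarked. For marked idempotents u = (x, y) and v,
    right multiplication keeps x and multiplies y by the value in S; as y absorbs the value of u,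
    the law in S gives u v u = u. *)
Lemma orthodoxJ_occurrence : orthodoxJ S -> orthodoxJ T.
Proof.
move=> OS [e|[x y]] [f|[x' y']] ee ff ef fe.
- have E := OS e f _ _ (leJ_occ_inl ef) (leJ_occ_inl fe).
  by congr inl; apply: E; [case: ee|case: ff].
- by have := leJ_occ_found ef isT.
- by have := leJ_occ_found fe isT.
pose u : T := inr (x, y); pose v : T := inr (x', y').
have uvu : occ_val u * occ_val v * occ_val u = occ_val u.
  apply: OS; rewrite -?occ_valM ?ee ?ff //; first exact: (leJ_hom occ_hom ef).
  exact: (leJ_hom occ_hom fe).
have yE : y * Some (occ_val u) = y.
  by have := occ_mul_inr x y (isT : occ_found u); rewrite ee => -[].
rewrite (@occ_mul_inr x y v isT) (@occ_mul_inr x _ u isT); congr (inr (_, _)).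
rewrite -{1}yE -!mulgA !omulE mulgA uvu.
exact: yE.
Qed.

(** A subgroup embeds in S by [occ_hom]: if its unit e is marked, g = e g is determined by e and the
    value of g in S. *)
Lemma subgroups_in_occurrence (H : semigroup_class) : 
  subgroups_in H S -> subgroups_in H T.
Proof.
move=> HS G h [e [eu ei]] hinj.
apply: (HS G (occ_hom \o h)); first by exists e.
move=> g k /= vgk; apply: hinj.
have foundE (i : G) : occ_found (h i) = occ_found (h e).
  apply/idP/idP => [hi|he]; last by rewrite -(proj1 (eu i)) gmulfM occ_foundM he.
  by have [j [<- _]] := ei i; rewrite gmulfM occ_foundM hi orbT.
rewrite -(proj1 (eu g)) -(proj1 (eu k)) !gmulfM.
move: (foundE g) (foundE k) vgk; case: (h e) => [s|[x y]].
  case: (h g) (h k) => [t|//] [t'|//] _ _ E.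
  by have -> : t = t' := E.
by move=> /= fg fk vgk; rewrite !occ_mul_inr // vgk.
Qed.

End Occurrence.

(** * Evaluation and content of pseudowords *)

(** The two-element semilattice, in which a pseudoword reveals whether a given letter occurs in
    it. *)
Definition orbs : Type := bool.

HB.instance Definition _ := Finite.copy orbs bool.
HB.instance Definition _ := hasMul.Build orbs orb.
HB.instance Definition _ := Magma_isSemigroup.Build orbs orbA.

Section Evaluation.
Variable A : finType.
Implicit Types (u v w : pseudoword A) (x y : option (pseudoword A)).

Definition ev w (S : finSemigroupType) (f : A -> S) : S := w S Logic.I f.

Lemma ev_nat (S T : finSemigroupType) (h : {multiplicative S -> T}) w (f : A -> S) :
  h (ev w f) = ev w (h \o f).
Proof. exact: pw_natural. Qed.

Lemma evM u v (S : finSemigroupType) (f : A -> S) : ev (u * v) f = ev u f * ev v f.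
Proof. by []. Qed.

Lemma ev_ext u v : (forall (S : finSemigroupType) (f : A -> S), ev u f = ev v f) -> u = v.
Proof. by move=> uv; apply: freeProV_ext => S []; exact: uv. Qed.

Lemma ev_pair w (S T : finSemigroupType) (f : A -> S) (g : A -> T) :
  ev w (fun a => (f a, g a) : (S * T)%type) = (ev w f, ev w g).
Proof.
pose h1 : {multiplicative (S * T)%type -> S} := fst.
pose h2 : {multiplicative (S * T)%type -> T} := snd.
rewrite [LHS]surjective_pairing; congr pair.
- exact (ev_nat h1 w _).
- exact (ev_nat h2 w _).
Qed.

(** The letters are mapped into the subsemigroup [P], and evaluation commutes with its inclusion;
    this replaces induction on words. *)
Lemma ev_ind (S : finSemigroupType) (P : set S) (f : A -> S) w :
  (forall s t, P s -> P t -> P (s * t)) -> (forall a, P (f a)) -> P (ev w f).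
Proof.
move=> PM Pf; pose v : {multiplicative subsg PM -> S} := @subsg_val S P PM.
have -> : ev w f = v (ev w (fun a => subsg_in PM (Pf a))) by rewrite ev_nat.
exact: subsg_valP.
Qed.

Lemma ev_ind2 (S T : finSemigroupType) (R : S -> T -> Prop) (f : A -> S) (g : A -> T) w :
  (forall s t s' t', R s t -> R s' t' -> R (s * s') (t * t')) ->
  (forall a, R (f a) (g a)) -> R (ev w f) (ev w g).
Proof.
move=> RM Rfg.
suff : (fun p => R p.1 p.2) (ev w (fun a => (f a, g a) : (S * T)%type)) by rewrite ev_pair.
by apply: (@ev_ind (S * T)%type (fun p => R p.1 p.2)) => // -[s t] [s' t']; exact: RM.
Qed.

(* {set A} itself cannot carry a [finSemigroupType], for universe reasons; the
   content is therefore defined one letter at a time. *)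
Definition content w : {set A} := [set a | (ev w (fun b => b == a : orbs) : bool)]%SET.

Lemma contentE a w : (a \in content w) = ev w (fun b => b == a : orbs).
Proof. by rewrite inE. Qed.

Lemma contentM u v : content (u * v) = (content u :|: content v)%SET.
Proof. by apply/setP => a; rewrite finset.in_setU !contentE evM. Qed.

Lemma content_gen a : content (pw_gen _ a) = [set a]%SET.
Proof. by apply/setP => b; rewrite contentE finset.in_set1; exact: eq_sym. Qed.

(** A finite power of [S], built from binary products, lets one evaluation record those under all
    the maps [fs a]. *)
Lemma joint_map (S : finSemigroupType) (fs : A -> A -> S) :
  exists (Q : finSemigroupType) (g : A -> Q) (p : A -> {multiplicative Q -> S}),
    forall a, p a \o g = fs a.
Proof.
suff [Q [g [p E]]] : exists (Q : finSemigroupType) (g : A -> Q)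
    (p : A -> {multiplicative Q -> S}), forall a, a \in enum A -> p a \o g = fs a.
  by exists Q, g, p => a; rewrite E // mem_enum.
elim: (enum A) => [|c r [Q [g [p E]]]].
  by exists S, (fun a => fs a a), (fun _ => idfun).
exists (S * Q)%type, (fun b => (fs c b, g b)).
pose h1 : {multiplicative (S * Q)%type -> S} := fst.
pose h2 a : {multiplicative (S * Q)%type -> S} := p a \o snd.
exists (fun a => if a == c then h1 else h2 a) => a.
by rewrite inE; case: eqP => [->|_] //= /E <-.
Qed.

(** In [Q] the content becomes a function of a single value, so the property is a relation between
    values in [Q] and in [S]. *)
Lemma ev_ind_letters (S : finSemigroupType) (P : {set A} -> S -> Prop) (f : A -> S) w :
  (forall C D s t, P C s -> P D t -> P (C :|: D)%SET (s * t)) ->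
  (forall a, P [set a]%SET (f a)) -> P (content w) (ev w f).
Proof.
move=> PM Pf; have [Q [g [p E]]] := joint_map (fun a b => b == a : orbs).
pose R (q : Q) (s : S) := P [set a | (p a q : bool)]%SET s.
have : R (ev w g) (ev w f).
  apply: ev_ind2 => [q s q' s' Rq Rq'|b]; rewrite /R.
    rewrite (_ : [set a | _]%SET = [set a | (p a q : bool)] :|: [set a | (p a q' : bool)])%SET.
      exact: PM.
    by apply/setP => a; rewrite !inE gmulfM.
  rewrite (_ : [set a | _]%SET = [set b]%SET) //.
  by apply/setP => a; rewrite !inE -[p a (g b)]/((p a \o g) b) E eq_sym.
congr (P _ _); apply/setP => a; rewrite contentE inE (ev_nat (p a)).
by rewrite E.
Qed.

Lemma ev_ind_content (S : finSemigroupType) (P : set S) (f : A -> S) w (C : {set A}) :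
  (forall s t, P s -> P t -> P (s * t)) -> (forall a, a \in C -> P (f a)) ->
  content w \subset C -> P (ev w f).
Proof.
move=> PM Pf; apply: (@ev_ind_letters S (fun D s => D \subset C -> P s)).
  by move=> D s D' s' Ps Ps'; rewrite finset.subUset => /andP[/Ps + /Ps']; exact: PM.
by move=> a; rewrite finset.sub1set; exact: Pf.
Qed.

Lemma content_neq0 w : content w != finset.set0.
Proof.
apply: (@ev_ind_letters orbs (fun C _ => C != finset.set0) (fun _ => true)).
  move=> C D _ _ /finset.set0Pn[a aC] _; apply/finset.set0Pn; exists a.
  by rewrite finset.in_setU aC.
by move=> a /=; apply/finset.set0Pn; exists a; rewrite inE.
Qed.

Definition oev x (S : finSemigroupType) (f : A -> S) : option S := omap (fun w => ev w f) x.

Lemma oevM x y (S : finSemigroupType) (f : A -> S) : oev (x * y) f = oev x f * oev y f.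
Proof. by case: x y => [u|] [v|]. Qed.

Lemma oev_ext x y : (forall (S : finSemigroupType) (f : A -> S), oev x f = oev y f) -> x = y.
Proof.
case: x y => [u|] [v|] // xy; last 2 first.
- by have := xy orbs (fun=> true).
- by have := xy orbs (fun=> true).
by congr Some; apply: ev_ext => S f; case: (xy S f).
Qed.

(** Comparison through the product with [orbs] shows that [F] is [None] either everywhere or
    nowhere. The letter [a] is a natural default value. *)
Lemma option_pseudoword (a : A) (F : forall S : finSemigroupType, (A -> S) -> option S) :
  (forall (S T : finSemigroupType) (h : {multiplicative S -> T}) (f : A -> S),
    omap h (F S f) = F T (h \o f)) ->
  exists x, forall (S : finSemigroupType) (f : A -> S), F S f = oev x f.
Proof.
move=> Fnat.
have wnat (S T : finSemigroupType) (IS : all_semigroups S) (IT : all_semigroups T)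
    (h : {multiplicative S -> T}) (f : A -> S) :
    h (odflt (f a) (F S f)) = odflt ((h \o f) a) (F T (h \o f)).
  by rewrite -Fnat; case: (F S f).
pose w := @FreeProV all_semigroups A (fun S _ f => odflt (f a) (F S f)) wnat.
pose sing (b : A) : orbs := true.
have isSomeF (S : finSemigroupType) (f : A -> S) : isSome (F S f) = isSome (F _ sing).
  pose h1 : {multiplicative (S * orbs)%type -> S} := fst.
  pose h2 : {multiplicative (S * orbs)%type -> orbs} := snd.
  pose g b : (S * orbs)%type := (f b, sing b).
  have := Fnat _ _ h1 g; have := Fnat _ _ h2 g.
  have -> : h1 \o g = f by [].
  have -> : h2 \o g = sing by [].
  by move=> <- <-; case: (F _ g).
exists (if isSome (F _ sing) then Some w else None) => S f.
by rewrite -(isSomeF S f) /w; case E: (F S f) => //=; rewrite /ev /= E.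
Qed.

End Evaluation.
Arguments ev : simpl never.
Arguments content : simpl never.

Definition eqV (V : semigroup_class) (A : finType) (u v : pseudoword A) : Prop :=
  forall S : finSemigroupType, V S -> forall f : A -> S, ev u f = ev v f.

Definition oeqV (V : semigroup_class) (A : finType) (x y : option (pseudoword A)) : Prop :=
  forall S : finSemigroupType, V S -> forall f : A -> S, oev x f = oev y f.

Lemma pw_projP (V : semigroup_class) (A : finType) (u v : pseudoword A) :
  pw_proj V u = pw_proj V v <-> eqV V u v.
Proof.
split=> [E S VS f|uv]; last by apply: freeProV_ext => S VS f; exact: uv.
by have := congr1 (fun w : freeProV V A => w S VS f) E.
Qed.

(** * Factoring at the first occurrence of a letter *)

Section FirstOccurrence.
Variables (A : finType) (a : A).
Implicit Types (u v w : pseudoword A) (x y : option (pseudoword A)).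

Definition omark (S : finSemigroupType) (f : A -> S) (b : A) : occurrence (f a) :=
  if b == a then inr (None, None) else inl (f b).

Lemma occ_val_mark (S : finSemigroupType) (f : A -> S) w :
  occ_val (ev w (omark f)) = ev w f.
Proof.
rewrite -[LHS]/(occ_hom _ _) ev_nat; congr (ev w _).
by apply/funext => b; rewrite /omark /=; case: eqP => [->|].
Qed.

Lemma occ_found_mark (S : finSemigroupType) (f : A -> S) w :
  occ_found (ev w (omark f)) = (a \in content w).
Proof.
rewrite contentE; apply: (@ev_ind2 _ _ _ (fun (s : occurrence (f a)) (b : orbs) =>
  occ_found s = b)) => [s b t b' sb tb'|b]; first by rewrite occ_foundM sb tb'.
by rewrite /omark; case: eqP.
Qed.

Lemma occ_mulr (S : finSemigroupType) (c : S) (x y : option S) (v : occurrence c) :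
  (inr (x, y) : occurrence c) * v = inr (x, y * Some (occ_val v)).
Proof. by case: v => [s|v] //; exact: occ_mul_inr. Qed.

Definition ocontent x : {set A} := odflt finset.set0 (omap (@content A) x).

Lemma ocontentM x y : ocontent (x * y) = (ocontent x :|: ocontent y)%SET.
Proof.
case: x y => [u|] [v|]; rewrite /ocontent /= ?finset.setU0 ?finset.set0U //.
exact: contentM.
Qed.

Lemma ev_first_occurrence w x y (S : finSemigroupType) (f : A -> S) :
  Some w = x * Some (pw_gen _ a) * y -> a \notin ocontent x ->
  ev w (omark f) = inr (oev x f, oev y f).
Proof.
have Egen : ev (pw_gen _ a) (omark f) = inr (None, None).
  by rewrite -[LHS]/(omark f a) /omark eqxx.
have Epre u : a \notin content u -> ev u (omark f) = inl (ev u f).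
  by rewrite -(occ_found_mark f) -(occ_val_mark f u); case: (ev u _).
case: x y => [u|] [v|] [->] ax; rewrite /= ?evM Egen ?(Epre u ax) ?occ_mulr ?occ_val_mark //.
Qed.

Definition occ_map (S T : finSemigroupType) (h : S -> T) (c : S) (s : occurrence c) :
    occurrence (h c) :=
  match s with inl s => inl (h s) | inr (x, y) => inr (omap h x, omap h y) end.

Lemma omapM (S T : finSemigroupType) (h : {multiplicative S -> T}) :
  {morph (omap h : option S -> option T) : x y / x * y >-> x * y}.
Proof. by move=> [s|] [t|] //=; rewrite gmulfM. Qed.

Lemma occ_mapM (S T : finSemigroupType) (h : {multiplicative S -> T}) (c : S) :
  {morph @occ_map S T h c : s t / s * t >-> s * t}.
Proof.
move=> [s|[x y]] [t|[x' y']] /=; rewrite ?gmulfM //.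
- by congr (inr (_, _)); exact: (omapM h (Some s)).
- by congr (inr (_, _)); exact: (omapM h y (Some t)).
- by congr (inr (_, _)); rewrite !omapM.
Qed.

(** The two components of the value of [w] in the semigroups [occurrence] are natural, hence are
    themselves given by pseudowords or by the adjoined unit. *)
Lemma first_occurrence w : a \in content w ->
  exists x y, Some w = x * Some (pw_gen _ a) * y /\ a \notin ocontent x.
Proof.
move=> aw.
pose pre (S : finSemigroupType) (f : A -> S) :=
  if ev w (omark f) is inr (x, y) then x else None.
pose post (S : finSemigroupType) (f : A -> S) :=
  if ev w (omark f) is inr (x, y) then y else None.
have mark_nat (S T : finSemigroupType) (h : {multiplicative S -> T}) (f : A -> S) :
    ev w (omark (h \o f)) = occ_map h (ev w (omark f)).
  pose hh : {multiplicative occurrence (f a) -> occurrence (h (f a))} :=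
    hom_of (occ_mapM h (c := f a)).
  rewrite -[RHS]/(hh _) ev_nat; congr (ev w _); apply/funext => b.
  by rewrite /omark /=; case: eqP.
have [x xE] : exists x, forall (S : finSemigroupType) (f : A -> S), pre S f = oev x f.
  apply: (option_pseudoword a) => S T h f.
  by rewrite /pre mark_nat; case: (ev w _) => [|[]].
have [y yE] : exists x, forall (S : finSemigroupType) (f : A -> S), post S f = oev x f.
  apply: (option_pseudoword a) => S T h f.
  by rewrite /post mark_nat; case: (ev w _) => [|[]].
exists x, y; split.
  apply: oev_ext => S f; rewrite !oevM -xE -yE /= -occ_val_mark occ_valE /pre /post.
  by have := occ_found_mark f w; rewrite aw; case: (ev w _) => [|[]].
(* Absence of [a] from [x] is tested in [orbs], with [a] the only letter sent to true: the part
   before the mark keeps the value false under products. *)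
pose isa b : orbs := b == a.
have -> : a \notin ocontent x = ~~ odflt false (pre orbs isa).
  by rewrite xE; case: x {xE} => [u|] /=; rewrite ?inE.
rewrite /pre.
have := @ev_ind A (occurrence (isa a)) [set s | match s with inl b => ~~ (b : bool)
   | inr (x, _) => ~~ odflt false (x : option bool) end] (omark isa) w.
case: (ev w _) => [s|[x' y']] //= P.
apply: P => [[b|[x1 y1]] [b'|[x2 y2]] //=|b].
- by move=> ab ab'; rewrite negb_or ab.
- by case: x2 => [b'|] //= ab ab'; rewrite negb_or ab.
- by rewrite /omark /isa; case: eqP.
Qed.

End FirstOccurrence.

(** * Closure properties of DO with subgroups in H *)

Section Membership.
Variables (H : semigroup_class) (HH : group_pseudovariety H).
Local Notation V := (DO_bar H).

Lemma group_in_H_sub (G G' : finSemigroupType) (f : {multiplicative G -> G'}) :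
  injective f -> H G' -> is_group G -> H G.
Proof. by case: HH => [[_ Hsub _ _] _] fi HG' [e _]; apply: (Hsub _ _ f) => //; exists e. Qed.

Lemma DO_bar_occurrence (S : finSemigroupType) (c : S) : V S -> V (occurrence c).
Proof.
case=> /DO_orthodoxJ OS HS; split; last exact: subgroups_in_occurrence.
exact/orthodoxJ_DO/orthodoxJ_occurrence.
Qed.

Lemma is_group_opposite (G : finSemigroupType) : is_group G -> is_group (opposite G).
Proof.
case=> e [eu ei]; exists e; split=> x; first by case: (eu x).
by case: (ei x) => y [yx xy]; exists y.
Qed.

(* Inversion is an isomorphism from a group onto its opposite. *)
Lemma DO_bar_opposite (S : finSemigroupType) : V S -> V (opposite S).
Proof.
case=> /DO_orthodoxJ OS HS; split; first exact/orthodoxJ_DO/orthodoxJ_opposite.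
move=> G f Ggrp fi.
have fM : {morph (fun x : opposite G => f (x : G) : S) : x y / x * y >-> x * y}.
  by move=> x y; exact (@gmulfM _ _ f y x).
have HG : H (opposite G).
  by apply: (HS _ (hom_of fM)); [exact: is_group_opposite|move=> x y /fi].
case: Ggrp => e [eu ei].
have [inv invP] := choice ei.
have invM : {morph (inv : G -> opposite G) : x y / x * y >-> x * y}.
  move=> x y; have [xx _] := invP x; have [yy yy'] := invP y; have [_ xy'] := invP (x * y).
  rewrite -[LHS](proj1 (eu _)) -[RHS]/((inv y : G) * (inv x : G)) -[RHS](proj2 (eu _)).
  rewrite -xy' !mulgA; congr (_ * _).
  by rewrite -(mulgA (inv y)) xx (proj2 (eu _)) yy.
apply: (group_in_H_sub (f := hom_of invM)) => //.
- move=> x y /= E; rewrite -[x](proj2 (eu _)) -(proj1 (invP y)) -E mulgA.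
  by rewrite (proj2 (invP x)) (proj1 (eu _)).
- by exists e.
Qed.

Lemma DO_bar_group (G : finSemigroupType) : H G -> V G.
Proof.
case: HH => HP Hgrp HG; split.
  apply: orthodoxJ_DO => e f ee ff _ _.
  by rewrite (proj1 (group_idem (Hgrp _ HG) ee f)) (proj1 (group_idem (Hgrp _ HG) ff e)).
by move=> K f Kgrp fi; exact: (group_in_H_sub fi).
Qed.

Lemma DO_bar_orbs : V orbs.
Proof.
split.
  apply: orthodoxJ_DO => e f _ _.
  by case: e f => [] [] //; case=> // -[] [] // [] // [].
move=> G f [e [eu ei]] fi; case: HH => [[_ _ Htriv _] _]; apply: Htriv.
have all_e x : x = e.
  apply: fi; have [y [yx _]] := ei x; have := proj1 (eu x).
  by rewrite -yx => /(congr1 f); rewrite !gmulfM; case: (f x) (f y) => [] [].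
apply/eqP; rewrite eqn_leq; apply/andP; split.
  by apply/fintype_le1P => x y; rewrite (all_e x) (all_e y).
by apply/card_gt0P; exists e.
Qed.

Lemma eqV_content A (u v : pseudoword A) : eqV V u v -> content u = content v.
Proof. by move=> uv; apply/setP => a; rewrite !contentE (uv _ DO_bar_orbs). Qed.

Lemma eqV_H A (u v : pseudoword A) : eqV V u v -> eqV H u v.
Proof. by move=> uv G HG; exact/uv/DO_bar_group. Qed.

End Membership.

(** * Reversal and uniqueness of the factorization *)

Section Reversal.
Variable A : finType.
Implicit Types (u v w : pseudoword A) (x y : option (pseudoword A)).

Lemma pw_rev_natural w (S T : finSemigroupType) (IS : all_semigroups S) (IT : all_semigroups T)
    (h : {multiplicative S -> T}) (f : A -> S) :
  h (ev w (f : A -> opposite S)) = ev w (h \o f : A -> opposite T).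
Proof.
have hM : {morph (h : opposite S -> opposite T) : x y / x * y >-> x * y}.
  by move=> x y; exact (@gmulfM _ _ h y x).
exact: (ev_nat (hom_of hM)).
Qed.

Definition pw_rev w : pseudoword A := FreeProV (pw_rev_natural w).

Lemma ev_pw_rev w (S : finSemigroupType) (f : A -> S) :
  ev (pw_rev w) f = ev w (f : A -> opposite S).
Proof. by []. Qed.

Lemma pw_revK : involutive pw_rev.
Proof.
move=> w; apply: ev_ext => S f; rewrite !ev_pw_rev.
have idM : {morph (id : opposite (opposite S) -> S) : x y / x * y >-> x * y} by [].
exact: (ev_nat (hom_of idM)).
Qed.

Lemma pw_revM u v : pw_rev (u * v) = pw_rev v * pw_rev u.
Proof. by apply: ev_ext. Qed.

Lemma pw_rev_gen a : pw_rev (pw_gen _ a) = pw_gen _ a.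
Proof. by apply: ev_ext. Qed.

Lemma content_pw_rev w : content (pw_rev w) = content w.
Proof.
apply/setP => a; rewrite !contentE ev_pw_rev.
have idM : {morph (id : opposite orbs -> orbs) : x y / x * y >-> x * y}.
  by move=> [] [].
exact: (ev_nat (hom_of idM)).
Qed.

(* With [d = true], statements about first occurrences and prefixes become
   statements about last occurrences and suffixes. *)
Definition dmul (T : semigroupType) (d : bool) (u v : T) := if d then v * u else u * v.

Lemma dmulA (T : semigroupType) d : associative (@dmul T d).
Proof. by case: d => u v w /=; rewrite /dmul mulgA. Qed.

Lemma dmul_first_occurrence d w a : a \in content w ->
  exists x y, Some w = dmul d (dmul d x (Some (pw_gen _ a))) y /\ a \notin ocontent x.
Proof.
case: d; last exact: first_occurrence.
rewrite -content_pw_rev => /first_occurrence[x [y [E ax]]].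
exists (omap pw_rev x), (omap pw_rev y); split; last first.
  by case: x ax {E} => //= u; rewrite /ocontent /= content_pw_rev.
rewrite -[w]pw_revK -[Some _]/(omap pw_rev (Some _)) E /dmul.
by case: x y {E ax} => [u|] [v|] //=; rewrite ?pw_revM ?pw_rev_gen ?mulgA.
Qed.

Section Cancellation.
Variables (H : semigroup_class).
Local Notation V := (DO_bar H).

(** The values of prefix and suffix are the components of one value in [occurrence (f a)], which
    lies in [V] when [S] does. *)
Lemma first_occurrence_unique a u v x y x' y' : eqV V u v ->
  Some u = x * Some (pw_gen _ a) * y -> a \notin ocontent x ->
  Some v = x' * Some (pw_gen _ a) * y' -> a \notin ocontent x' ->
  oeqV V x x' /\ oeqV V y y'.
Proof.
move=> uv E ax E' ax'; split=> S VS f.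
all: have := uv _ (DO_bar_occurrence (f a) VS) (omark a f).
all: by rewrite (ev_first_occurrence f E ax) (ev_first_occurrence f E' ax') => -[].
Qed.

(** Reversal turns last occurrences into first ones and respects equality over [V], because [V] is
    closed under opposites. *)
Lemma dmul_first_occurrence_unique d a u v x y x' y' : group_pseudovariety H -> eqV V u v ->
  Some u = dmul d (dmul d x (Some (pw_gen _ a))) y -> a \notin ocontent x ->
  Some v = dmul d (dmul d x' (Some (pw_gen _ a))) y' -> a \notin ocontent x' ->
  oeqV V x x' /\ oeqV V y y'.
Proof.
case: d => HH; last exact: first_occurrence_unique.
move=> uv E ax E' ax'.
have orevE z z' : oeqV V (omap pw_rev z) (omap pw_rev z') -> oeqV V z z'.
  have orevK : cancel (omap pw_rev) (omap pw_rev) by case=> //= t; rewrite pw_revK.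
  move=> zz' S VS f; have := zz' _ (DO_bar_opposite HH VS) f.
  have ez t : oev (omap pw_rev t) (f : A -> opposite S) =
    oev (omap pw_rev (omap pw_rev t)) f by case: t.
  by rewrite !ez !orevK.
have orev_eq t z z' : Some t = dmul true (dmul true z (Some (pw_gen _ a))) z' ->
    Some (pw_rev t) = omap pw_rev z * Some (pw_gen _ a) * omap pw_rev z'.
  by rewrite /dmul; case: z z' => [?|] [?|] [->] //=; rewrite ?pw_revM ?pw_rev_gen ?mulgA.
have orev_ct z : ocontent (omap pw_rev z) = ocontent z.
  by case: z => //= t; rewrite /ocontent /= content_pw_rev.
have ruv : eqV V (pw_rev u) (pw_rev v).
  by move=> S VS f; rewrite !ev_pw_rev; exact (uv _ (DO_bar_opposite HH VS) f).
have [X Y] : oeqV V (omap pw_rev x) (omap pw_rev x') /\ oeqV V (omap pw_rev y) (omap pw_rev y').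
  by apply: (first_occurrence_unique ruv (orev_eq _ _ _ E) _ (orev_eq _ _ _ E')); rewrite orev_ct.
by split; exact: orevE.
Qed.

End Cancellation.
End Reversal.

(** * Regular J-classes over DO and over H *)

Definition omega (A : finType) (w : pseudoword A) : pseudoword A :=
  pw_op omega_pw (fun _ => w).

Lemma ev_omega A (w : pseudoword A) (S : finSemigroupType) (f : A -> S) :
  ev (omega w) f = omega_pow (ev w f).
Proof. by []. Qed.

Lemma leJ_letter A (w : pseudoword A) a (S : finSemigroupType) (f : A -> S) :
  a \in content w -> leJ (ev w f) (f a).
Proof.
move=> /first_occurrence[x [y [E _]]]; apply/leJP; exists (oev x f), (oev y f).
by rewrite -[Some (ev w f)]/(oev (Some w) f) E !oevM.
Qed.

Section AboveLetters.
Variables (H : semigroup_class) (A : finType) (S : finSemigroupType).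
Hypotheses (OS : orthodoxJ S) (HS : subgroups_in H S).
Variables (f : A -> S) (e : S) (C : {set A}).
Hypotheses (ee : e * e = e) (eC : forall a, a \in C -> leJ e (f a)).

Lemma above_ev w : content w \subset C -> leJ e (ev w f).
Proof. by move=> wC; apply: (@ev_ind_content _ _ (leJ e) f w C) => //; exact: aboveM. Qed.

(** By [corner_mul], t |-> e t e is multiplicative on products of letters of [C], so it is an
    evaluation in the maximal subgroup at [e]. Letters outside [C] get a dummy value. *)
Lemma corner_ev : exists g : A -> units e, forall w, content w \subset C ->
  units_val e (ev w g) = e * ev w f * e.
Proof.
have /choice[g gE] : forall a, exists u : units e, a \in C -> units_val e u = e * f a * e.
  have [u0 _] := units_group ee.
  move=> a; case: (boolP (a \in C)) => [/eC ea|_]; last by exists u0.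
  by exists (subsg_in (@unit_atM S e) (unit_corner OS ee ea)).
exists g => w wC.
suff [] : (fun p : (S * units e)%type => leJ e p.1 /\ units_val e p.2 = e * p.1 * e)
    (ev w (fun a => (f a, g a) : (S * units e)%type)) by rewrite ev_pair.
apply: (@ev_ind_content A (S * units e)%type
  (fun p => leJ e p.1 /\ units_val e p.2 = e * p.1 * e) _ w C) => //
  [[s u] [t v] [/= es us] [/= et vt]|a aC].
  split; first exact: aboveM.
  transitivity (units_val e u * units_val e v); first exact (@gmulfM _ _ (units_val e) u v).
  by rewrite /= us vt corner_mul.
by split; [exact: eC | exact: gE].
Qed.

Lemma units_in_H : H (units e).
Proof.
exact (@HS (units e) (units_val e) (units_group ee) (@subsg_val_inj _ _ _)).
Qed.

Lemma corner_eqV_H u v : content u \subset C -> content v \subset C -> eqV H u v ->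
  e * ev u f * e = e * ev v f * e.
Proof.
have [g gE] := corner_ev; move=> uC vC uv.
by rewrite -!gE // (uv _ units_in_H).
Qed.

Lemma corner_idem_H w : content w \subset C -> eqV H w (w * w) -> e * ev w f * e = e.
Proof.
have [g gE] := corner_ev; move=> wC ww; rewrite -gE //.
have [ez ze [y [_ _ zy _]]] : unit_at e (units_val e (ev w g)) := subsg_valP _.
have := congr1 (units_val e) (ww _ units_in_H g); rewrite evM gmulfM => zz.
move: (units_val e _) ez ze zy zz => z _ ze zy zz.
by rewrite -{1}ze -zy mulgA -zz.
Qed.

End AboveLetters.

Section Middle.
Variables (H : semigroup_class) (A : finType).
Implicit Types (M N P Q t : pseudoword A).
Local Notation V := (DO_bar H).

Lemma omega_above M (S : finSemigroupType) (f : A -> S) a :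
  a \in content M -> leJ (ev (omega M) f) (f a).
Proof.
move=> aM; rewrite ev_omega; have [y [<- _]] := omega_pow_inv (ev M f).
exact: leJ_trans (leJ_mulr _ _) (leJ_letter f aM).
Qed.

Lemma content_omega M : content (omega M) = content M.
Proof.
by apply/setP => a; rewrite !contentE ev_omega omega_pow_id //; case: (ev M _).
Qed.

(** Let e, f be the values of the omega powers. Equal contents make them J-equivalent, so e t f = e
    t e f, where e t e depends only on t over H. *)
Lemma middle_eqV M N t t' : content M = content N ->
  content t \subset content M -> content t' \subset content M -> eqV H t t' ->
  eqV V (omega M * t * omega N) (omega M * t' * omega N).
Proof.
move=> MN tM t'M tt' S [/DO_orthodoxJ OS HS] f; rewrite !evM.
have ee := omega_pow_idem (ev M f); have ff := omega_pow_idem (ev N f).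
have eM := omega_above f; have aM := above_ev OS ee (eM M); have aN := above_ev OS ff (eM N).
have ef : leJ (ev (omega M) f) (ev (omega N) f) by apply: aM; rewrite content_omega MN.
have fe : leJ (ev (omega N) f) (ev (omega M) f) by apply: aN; rewrite content_omega MN.
rewrite (idem_absorb OS ee ff ef fe (aM _ tM)) (idem_absorb OS ee ff ef fe (aM _ t'M)).
by congr (_ * _); apply: (corner_eqV_H OS HS ee (eM M)).
Qed.

(** The value e of the omega power is a factor of w and lies J-below its letters, hence is
    J-equivalent to w; idempotency over H gives e w e = e, and [corner_idem] applies. *)
Lemma middle_idem w M P Q : w = P * omega M * Q -> content w = content M ->
  eqV H w (w * w) -> eqV V w (w * w).
Proof.
move=> wE wM ww S [/DO_orthodoxJ OS HS] f; rewrite !evM.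
have ee := omega_pow_idem (ev M f).
have eM := omega_above f (M := M); have aM := above_ev OS ee eM.
have wM' : content w \subset content M by rewrite wM.
symmetry; apply: (corner_idem OS ee (aM _ wM')).
  by rewrite wE !evM; exact: leJ_mid.
exact: corner_idem_H wM' ww.
Qed.

End Middle.

(** * Continuous homomorphisms *)

Section Continuity.
Variable A : finType.

Lemma cvg_initial (S : choiceType) (T : topologicalType) (f : S -> T)
    (F : set_system S) (s : S) : Filter F ->
  f @ F --> f s -> F --> (s : initial_topology f).
Proof.
move=> FF cv B /= [_ [[C oC <-] Cs sub]].
by apply: filterS sub _; apply: cv; exact: open_nbhs_nbhs.
Qed.

Lemma cvg_pseudoword (F : set_system (pseudoword A)) (w : pseudoword A) : Filter F ->
  (forall (S : finSemigroupType) (f : A -> S), F [set v | ev v f = ev w f]) -> F --> w.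
Proof.
move=> FF Fw; apply: cvg_initial; apply/cvg_sup => -[S [] f].
apply: cvg_initial => B /principal_filterP Bw.
suff : F [set v | B (ev v f)] by [].
by apply: filterS (Fw S f) => v /= ->.
Qed.

Lemma nbhs_ev (w : pseudoword A) (S : finSemigroupType) (f : A -> S) :
  nbhs w [set v | ev v f = ev w f].
Proof.
pose i : marked all_semigroups A := Marked Logic.I f.
pose P := prod_topology (fun i : marked all_semigroups A => discrete_topology (mk_sort i)).
have fc : continuous (@pw_family all_semigroups A : pseudoword A -> P).
  exact: initial_continuous.
apply: (fc w [set g : P | g i = ev w f]).
have /cvg_sup/(_ i) cvgi : nbhs (pw_family w : P) --> (pw_family w : P) by exact: cvg_id.
apply: (cvgi [set g : P | g i = ev w f]).
have pc := @initial_continuous _ (discrete_topology (mk_sort i)) (fun g : P => g i).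
apply: (pc (pw_family w) [set x | x = ev w f]).
by apply/principal_filterP.
Qed.

Lemma continuous_discreteP (T : choiceType) (h : pseudoword A -> T) :
  continuous (h : pseudoword A -> discrete_topology T) <->
  forall w, nbhs w [set v | h v = h w].
Proof.
split=> [hc w|hc w B /principal_filterP Bw].
  by apply: (hc w [set x | x = h w]); apply/principal_filterP.
by apply: (filterS _ (hc w)) => v /= E; rewrite /= E.
Qed.

Lemma ev_spow (w : pseudoword A) n (S : finSemigroupType) (f : A -> S) :
  ev (spow w n) f = spow (ev w f) n.
Proof. by elim: n => //= n <-. Qed.

(** The predecessor appears because [spow x m] has exponent m + 1; for large k, k! is a multiple of
    the exponent of an idempotent power. *)
Lemma spow_fact (S : finSemigroupType) (x : S) :
  exists n, forall k, (n <= k)%N -> spow x (k`!).-1 = omega_pow x.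
Proof.
have [n En] := omega_spow x; exists n.+1 => k nk.
have /dvdnP[j kj] : (n.+1 %| k`!)%N by apply: dvdn_fact.
have j0 : (0 < j)%N by move: (fact_gt0 k); rewrite kj; case: (j).
rewrite kj mulnC -{1}(prednK j0) -spowM -En spow_idem //.
exact: omega_pow_idem.
Qed.

(** [omega w] is the limit of the powers of w with exponents k!, along which a continuous map to a
    discrete space eventually takes its limit value. *)
Lemma hom_omega (S : finSemigroupType) (phi : {multiplicative pseudoword A -> S})
    (w : pseudoword A) :
  continuous (phi : pseudoword A -> discrete_topology S) ->
  phi (omega w) = omega_pow (phi w).
Proof.
move=> /continuous_discreteP phic.
have cvgw : (fun k => spow w (k`!).-1) @ \oo --> omega w.
  apply: cvg_pseudoword => S' f; have [n nP] := spow_fact (ev w f).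
  by exists n => // k /= nk; rewrite ev_spow nP.
have [n _ nP] : \oo [set k | phi (spow w (k`!).-1) = phi (omega w)] := cvgw _ (phic _).
have [m mP] := spow_fact (phi w).
rewrite -(nP (n + m)%N); last by rewrite /= leq_addr.
by rewrite spow_natural mP // leq_addl.
Qed.

End Continuity.

(** Every product is [false] here, so the value [true] forces a pseudoword to be a single letter. *)
Definition nulls : Type := bool.

HB.instance Definition _ := Finite.copy nulls bool.
HB.instance Definition _ := hasMul.Build nulls (fun _ _ => false).

Lemma nulls_mulA : associative (fun _ _ : nulls => false : nulls).
Proof. by []. Qed.

HB.instance Definition _ := Magma_isSemigroup.Build nulls nulls_mulA.

Lemma ev_nulls A (w : pseudoword A) (a : A) :
  (ev w (fun b => b == a : nulls) : bool) -> w = pw_gen _ a.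
Proof.
move=> wa; apply: ev_ext => S f.
have := @ev_ind2 A nulls S (fun n s => (n : bool) -> s = f a) (fun b => b == a) f w.
by apply=> // b /eqP ->.
Qed.

(** Pairing [phi] with detectors of content and of single letters, then restricting to the image,
    ensures that replacements keep their content and leave letters unchanged. *)
Lemma refine_hom (A : finType) (S : finSemigroupType)
    (phi : {multiplicative pseudoword A -> S}) :
  continuous (phi : pseudoword A -> discrete_topology S) ->
  exists (F : finSemigroupType) (Phi : {multiplicative pseudoword A -> F}),
  [/\ onto_continuous Phi,
      forall u v, Phi u = Phi v -> phi u = phi v,
      forall u v, Phi u = Phi v -> content u = content v
    & forall u a, Phi u = Phi (pw_gen _ a) -> u = pw_gen _ a].
Proof.
move=> /continuous_discreteP phic.
have [Q1 [g1 [p1 E1]]] := joint_map (fun a b : A => b == a : orbs).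
have [Q2 [g2 [p2 E2]]] := joint_map (fun a b : A => b == a : nulls).
pose psi w : (S * Q1 * Q2)%type := ((phi w, ev w g1), ev w g2).
have psiM : {morph psi : u v / u * v >-> u * v}.
  by move=> u v; rewrite /psi gmulfM.
have imM (x y : (S * Q1 * Q2)%type) : range psi x -> range psi y -> range psi (x * y).
  by move=> [u _ <-] [v _ <-]; exists (u * v); rewrite ?psiM.
have im w : range psi (psi w) by exists w.
pose Phi0 w : subsg imM := subsg_in imM (im w).
have Phi0M : {morph Phi0 : u v / u * v >-> u * v}.
  by move=> u v; apply: subsg_val_inj; exact: psiM.
have PhiE u v : Phi0 u = Phi0 v -> psi u = psi v by move/(congr1 (@subsg_val _ _ _)).
exists (subsg imM : finSemigroupType), (hom_of Phi0M); split.
- split; last by move=> s; have [w _ ws] := subsg_valP s; exists w; exact: subsg_val_inj.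
  apply/continuous_discreteP => w; have n1 := nbhs_ev w g1; have n2 := nbhs_ev w g2.
  apply: filterS (filterI (filterI (phic w) n1) n2) => v [[/= vw vw1] vw2].
  by apply: subsg_val_inj; rewrite /= /psi vw vw1 vw2.
- by move=> u v /PhiE[].
- move=> u v /PhiE[_ uv _]; apply/setP => a; rewrite !contentE -E1.
  by rewrite -!(ev_nat (p1 a)) uv.
- move=> u a /PhiE[_ _ ua]; apply: ev_nulls.
  rewrite -E2 -(ev_nat (p2 a)) ua (ev_nat (p2 a)) E2.
  by rewrite -[ev _ _]/(a == a).
Qed.

(** * Replacing pseudowords by sigma-terms *)

Lemma oeqV_ocontent (H : semigroup_class) A (x y : option (pseudoword A)) :
  group_pseudovariety H -> oeqV (DO_bar H) x y -> ocontent x = ocontent y.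
Proof.
move=> HH; case: x y => [u|] [v|] xy //; last 2 first.
- by have := xy _ (DO_bar_orbs HH) (fun _ => true).
- by have := xy _ (DO_bar_orbs HH) (fun _ => true).
by apply: (eqV_content HH) => S VS f; case: (xy S VS f).
Qed.

Lemma stable_omega (S : finSemigroupType) (d : bool) (p m : S) :
  dmul d p m = p -> dmul d p (omega_pow m) = p.
Proof.
move=> pm; have [n ->] := omega_spow m; elim: n => //= n.
by case: d pm; rewrite /dmul => pm IH; [rewrite -mulgA IH|rewrite mulgA pm].
Qed.

Lemma Forall2_seq1 T (R : T -> T -> Prop) l L :
  List.Forall2 R [:: l] L -> exists2 l', L = [:: l'] & R l l'.
Proof.
move=> h; inversion_clear h as [|? l' ? r Rl nil]; exists l' => //.
by inversion_clear nil.
Qed.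

Section SigmaTerms.
Variables (sigma : signature) (A : finType).
Hypothesis sigmaM : implicit_signature sigma.

Lemma sigma_mul (u v : pseudoword A) :
  sigma_subalgebra sigma u -> sigma_subalgebra sigma v -> sigma_subalgebra sigma (u * v).
Proof.
move=> su sv; pose t (i : 'I_2) := if i == ord0 then u else v.
have -> : u * v = pw_op mul_pw t by exact: ev_ext.
by apply: SigmaOp => // i; rewrite /t; case: eqP.
Qed.

Lemma sigma_add_omega (u : pseudoword A) :
  sigma_subalgebra sigma u -> sigma_subalgebra (add_omega sigma) u.
Proof.
elim=> [a|n w t sw _ IH]; first exact: SigmaGen.
by apply: SigmaOp => //; left.
Qed.

Lemma sigma_omega (u : pseudoword A) :
  sigma_subalgebra (add_omega sigma) u -> sigma_subalgebra (add_omega sigma) (omega u).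
Proof. by move=> su; apply: SigmaOp => //; right. Qed.

End SigmaTerms.

Section Factorization.
Variables (H : semigroup_class) (HH : group_pseudovariety H).
Local Notation V := (DO_bar H).
Variables (sigma0 : signature) (A : finType).
Hypothesis sigma0M : implicit_signature sigma0.
Local Notation sigma_term := (@sigma_subalgebra (add_omega sigma0) A).
Variables (F : finSemigroupType) (Phi : {multiplicative pseudoword A -> F}).
Hypothesis Phi_content : forall u v, Phi u = Phi v -> content u = content v.
Hypothesis Phi_gen : forall u a, Phi u = Phi (pw_gen _ a) -> u = pw_gen _ a.
Hypothesis Phi_omega : forall u, Phi (omega u) = omega_pow (Phi u).
Variables (I : finType) (i0 : I).
Implicit Types (u v w l p y : I -> pseudoword A) (B : {set A}) (L : seq (I -> pseudoword A)).

Definition constV (W : semigroup_class) u := forall i j, eqV W (u i) (u j).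

Definition lprod L i : option (pseudoword A) := foldr (fun l x => Some (l i) * x) None L.

Lemma lprod_cons l L i : lprod (l :: L) i = Some (l i) * lprod L i. Proof. by []. Qed.

Lemma lprod_cat L L' i : lprod (L ++ L') i = lprod L i * lprod L' i.
Proof. by elim: L => //= l L IH; rewrite IH mulgA. Qed.

Definition refines l l' :=
  [/\ forall i, sigma_term (l' i), forall i, Phi (l' i) = Phi (l i) & constV H l'].

(* The tuple [u] can be replaced by a tuple of sigma-terms as soon as each of
   its factors in some list [L] can, where on these factors only equality over
   H is requested. *)
Definition reducible (Q : (I -> pseudoword A) -> Prop) u :=
  constV V u /\ exists L,
  [/\ forall i, lprod L i = Some (u i), List.Forall (constV H) L
    & forall L', List.Forall2 refines L L' -> exists w,
      [/\ forall i, sigma_term (w i), forall i, Phi (w i) = Phi (u i), constV V w,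
          forall i, oeqV H (Some (w i)) (lprod L' i) & Q w]].

Local Notation reducibleT := (reducible (fun _ => True)).

Definition idemV (W : semigroup_class) u := forall i, eqV W (u i) (u i * u i).

Definition reg u := exists m, forall i, eqV V (u i) (u i * m * u i).

Definition tmul d u v : I -> pseudoword A := fun i => dmul d (u i) (v i).

Lemma reducible_weaken (Q Q' : (I -> pseudoword A) -> Prop) u :
  (forall w, Q w -> Q' w) -> reducible Q u -> reducible Q' u.
Proof.
move=> QQ' [Vu [L [LE LH Lred]]]; split=> //; exists L; split=> // L' /Lred[w [? ? ? ? Qw]].
by exists w; split=> //; exact: QQ'.
Qed.

Lemma eqV_mul (W : semigroup_class) (u u' v v' : pseudoword A) :
  eqV W u u' -> eqV W v v' -> eqV W (u * v) (u' * v').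
Proof. by move=> uu' vv' S WS f; rewrite !evM uu' // vv'. Qed.

Lemma eqV_omega (W : semigroup_class) (u u' : pseudoword A) :
  eqV W u u' -> eqV W (omega u) (omega u').
Proof. by move=> uu' S WS f; rewrite !ev_omega uu'. Qed.

Lemma eqV_dmul (W : semigroup_class) d (u u' v v' : pseudoword A) :
  eqV W u u' -> eqV W v v' -> eqV W (dmul d u v) (dmul d u' v').
Proof. by case: d => uu' vv'; exact: eqV_mul. Qed.

Lemma constV_tmul W d u v : constV W u -> constV W v -> constV W (tmul d u v).
Proof. by move=> Wu Wv i j; exact: eqV_dmul. Qed.

Lemma constV_H u : constV V u -> constV H u.
Proof. by move=> Vu i j; exact: eqV_H. Qed.

Lemma content_dmul d (u v : pseudoword A) : content (dmul d u v) = (content u :|: content v)%SET.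
Proof. by case: d; rewrite /dmul contentM // finset.setUC. Qed.

Lemma reducible_gen a : reducibleT (fun _ => pw_gen _ a).
Proof.
split; first by move=> i j.
exists [:: (fun _ => pw_gen _ a)]; split=> //; first by constructor.
move=> L' h; have [l' -> [sl Phil _]] := Forall2_seq1 h; exists l'; split=> // i j.
have E k : l' k = pw_gen _ a by exact: Phi_gen.
by rewrite !E.
Qed.

Lemma reducible_mul u v : reducibleT u -> reducibleT v -> reducibleT (fun i => u i * v i).
Proof.
move=> [Vu [Lu [LuE LuH ured]]] [Vv [Lv [LvE LvH vred]]].
split; first exact: (@constV_tmul _ false).
exists (Lu ++ Lv); split; first by move=> i; rewrite lprod_cat LuE LvE.
  by apply/List.Forall_app.
move=> L' /List.Forall2_app_inv_l[Lu' [Lv' [/ured[w [sw Pw Vw Hw _]]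
  [/vred[z [sz Pz Vz Hz _]] ->]]]].
exists (fun i => w i * z i); split=> // [i|i||i G HG f].
- by apply: sigma_mul => //; left.
- by rewrite !gmulfM Pw Pz.
- exact: (@constV_tmul _ false).
- by rewrite lprod_cat oevM -Hw // -Hz.
Qed.

Lemma reducible_tmul d u v : reducibleT u -> reducibleT v -> reducibleT (tmul d u v).
Proof. by case: d => ru rv; exact: reducible_mul. Qed.

(* [u = P M t N Q] is replaced by [P' M'^omega M' t' N' N'^omega Q']: the powers
   are invisible to [Phi] and to H, and place the middle factor in a regular
   J-class, where over V only its value over H matters. *)
Lemma reducible_sandwich B P M t N Q :
  reducibleT P -> reducibleT M -> constV H t -> reducibleT N -> reducibleT Q ->
  (forall i, content (M i) = B) -> (forall i, content (N i) = B) ->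
  (forall i, content (P i) \subset B) -> (forall i, content (t i) \subset B) ->
  (forall i, content (Q i) \subset B) ->
  (forall i, Phi (P i) = Phi (P i * M i)) -> (forall i, Phi (Q i) = Phi (N i * Q i)) ->
  constV V (fun i => P i * M i * t i * N i * Q i) ->
  reducible (fun w => idemV H w -> idemV V w) (fun i => P i * M i * t i * N i * Q i).
Proof.
move=> [VP [LP [LPE LPH Pred]]] [VM [LM [LME LMH Mred]]] Ht.
move=> [VN [LN [LNE LNH Nred]]] [VQ [LQ [LQE LQH Qred]]] MB NB PB tB QB PhiP PhiQ Vu.
split=> //; exists (LP ++ LM ++ [:: t] ++ LN ++ LQ); split.
- by move=> i; rewrite !lprod_cat LPE LME LNE LQE /= !omulE !mulgA.
- do 2 (apply/List.Forall_app; split=> //).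
  by constructor=> //; apply/List.Forall_app.
move=> ? /List.Forall2_app_inv_l[LP' [? [/Pred[P' [sP PhiP' VP' HP _]] [+ ->]]]].
move=> /List.Forall2_app_inv_l[LM' [? [/Mred[M' [sM PhiM' VM' HM _]] [+ ->]]]].
move=> /(@List.Forall2_app_inv_l _ _ _ [:: t])[Lt [? [tE [+ ->]]]].
move=> /List.Forall2_app_inv_l[LN' [LQ' [/Nred[N' [sN PhiN' VN' HN _]]
  [/Qred[Q' [sQ PhiQ' VQ' HQ _]] ->]]]].
have [t' -> [st Phit Ht']] := Forall2_seq1 tE.
have CM i : content (M' i) = B by rewrite (Phi_content (PhiM' i)).
have CN i : content (N' i) = B by rewrite (Phi_content (PhiN' i)).
have CP i : content (P' i) \subset B by rewrite (Phi_content (PhiP' i)).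
have CQ i : content (Q' i) \subset B by rewrite (Phi_content (PhiQ' i)).
have Ct i : content (t' i) \subset B by rewrite (Phi_content (Phit i)).
pose X i := M' i * t' i * N' i.
have CX i : content (X i) \subset B by rewrite !contentM CM CN !finset.subUset Ct subxx.
exists (fun i => P' i * (omega (M' i) * X i * omega (N' i)) * Q' i).
have sM' (z z' : pseudoword A) : sigma_term z -> sigma_term z' -> sigma_term (z * z').
  by apply: sigma_mul; left.
have Hone (G : finSemigroupType) : H G ->
    forall x z : G, omega_pow x * z = z /\ z * omega_pow x = z.
  move=> HG x; apply: group_idem (omega_pow_idem x).
  by case: HH => _; apply.
split=> [i|i|i j|i G HG f|wH i].
- apply: (sM' _ _ _ (sQ i)); apply: (sM' _ _ (sP i)).
  apply: (sM' _ _ _ (sigma_omega (sN i))); apply: (sM' _ _ (sigma_omega (sM i))).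
  by apply: (sM' _ _ _ (sN i)); exact: sM'.
- rewrite !gmulfM !Phi_omega PhiP' PhiQ' PhiM' PhiN' Phit !mulgA.
  have pm : Phi (P i) * omega_pow (Phi (M i)) = Phi (P i).
    by apply: (stable_omega (d := false)); rewrite /dmul -gmulfM -PhiP.
  have nq : omega_pow (Phi (N i)) * Phi (Q i) = Phi (Q i).
    by apply: (stable_omega (d := true)); rewrite /dmul -gmulfM -PhiQ.
  by rewrite pm -(mulgA _ (omega_pow _)) nq.
- apply: eqV_mul (VQ' i j); apply: eqV_mul (VP' i j) _.
  (* [middle_eqV] passes from [X i] to [X j], known to agree only over H; the powers and the outer
     factors are constant over [V]. *)
  move=> S VS f; transitivity (ev (omega (M' i) * X j * omega (N' i)) f).
    apply: middle_eqV VS f; rewrite ?CM ?CN //.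
    by apply: eqV_mul (constV_H VN' i j); apply: eqV_mul (constV_H VM' i j) (Ht' i j).
  apply: (eqV_mul _ _ VS f); last by apply: eqV_omega; exact: VN'.
  by apply: eqV_mul => //; apply: eqV_omega; exact: VM'.
- rewrite !lprod_cat lprod_cons !lprod_cat !oevM -HP // -HM // -HN // -HQ //= !omulE; congr Some.
  have E1 z := proj1 (Hone _ HG (ev (M' i) f) z).
  have E2 z := proj2 (Hone _ HG (ev (N' i) f) z).
  rewrite (evM (_ * _)) (evM (P' i)) (evM _ (omega _)) (evM (omega _)) !ev_omega E1 E2.
  by rewrite !evM !mulgA.
- have wE : P' i * (omega (M' i) * X i * omega (N' i)) * Q' i =
     P' i * omega (M' i) * (X i * omega (N' i) * Q' i) by rewrite !mulgA.
  apply: (middle_idem wE) (wH i).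
  rewrite (contentM (_ * _)) (contentM (P' i)) (contentM _ (omega _)) (contentM (omega _)).
  rewrite !content_omega CM CN; apply/eqP; rewrite finset.eqEsubset.
  rewrite !finset.subUset CP CQ CX subxx /=.
  apply: fintype.subset_trans (finset.subsetUl _ _).
  apply: fintype.subset_trans (finset.subsetUr _ _).
  exact: finset.subsetUr.
Qed.

Lemma dmul_Some d (z z' : pseudoword A) : dmul d (Some z) (Some z') = Some (dmul d z z').
Proof. by case: d. Qed.

Lemma ocontent_dmul d (x x' : option (pseudoword A)) :
  ocontent (dmul d x x') = (ocontent x :|: ocontent x')%SET.
Proof. by case: d; rewrite /dmul ocontentM // finset.setUC. Qed.

Lemma constV_content u : constV V u -> forall i j, content (u i) = content (u j).
Proof. by move=> Vu i j; exact: (eqV_content HH (Vu i j)). Qed.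

(** Choose the letter a whose prefix x has the largest content. A letter b of z other than a and not
    in x would first occur after a, and the prefix before b would contain a as well, contradicting
    maximality. *)
Lemma last_first_occurrence d (z : pseudoword A) :
  exists (a : A) (x y : option (pseudoword A)),
  [/\ Some z = dmul d (dmul d x (Some (pw_gen _ a))) y, a \notin ocontent x
    & content z = (a |: ocontent x)%SET].
Proof.
have /choice[X XP] : forall a, exists xy : option (pseudoword A) * option (pseudoword A),
    a \in content z ->
    Some z = dmul d (dmul d xy.1 (Some (pw_gen _ a))) xy.2 /\ a \notin ocontent xy.1.
  move=> a; case: (boolP (a \in content z)) => [|_]; last by exists (None, None).
  by move/(dmul_first_occurrence d) => [x [y E]]; exists (x, y).
have /finset.set0Pn[a0 a0z] := content_neq0 z.
case: (@arg_maxnP _ a0 (mem (content z)) (fun a => #|ocontent (X a).1|) a0z) => a az amax.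
have [E ax] := XP a az; exists a, (X a).1, (X a).2; split=> //.
have zE : content z = (a |: ocontent (X a).1 :|: ocontent (X a).2)%SET.
  rewrite -[content z]/(ocontent (Some z)) {1}E !ocontent_dmul (finset.setUC (ocontent _)).
  by rewrite /ocontent /= content_gen.
apply/eqP; rewrite finset.eqEsubset {2}zE finset.subsetUl andbT.
apply/fintype.subsetP => b bz; apply: contraT => nb.
have [Eb bx] := XP b bz.
have : b \in ocontent (X a).2 by move: bz; rewrite zE finset.in_setU (negbTE nb).
case Ya : (X a).2 => [y|]; last by rewrite inE.
rewrite {1}/ocontent /= => /(dmul_first_occurrence d)[x' [y' [Ey bx']]].
have E2 : Some z = dmul d (dmul d (dmul d (dmul d (X a).1 (Some (pw_gen _ a))) x')
    (Some (pw_gen _ b))) y' by rewrite {1}E Ya Ey !dmulA.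
have bx2 : b \notin ocontent (dmul d (dmul d (X a).1 (Some (pw_gen _ a))) x').
  rewrite !ocontent_dmul finset.in_setU negb_or bx' andbT.
  by move: nb; rewrite finset.setUC /ocontent /= content_gen.
have [/(oeqV_ocontent HH) xx _] :=
  dmul_first_occurrence_unique HH (fun S _ f => erefl) Eb bx E2 bx2.
have /= := amax b bz; rewrite leqNgt => /negP[]; apply: proper_card; rewrite xx.
apply/fintype.properP; split; first by rewrite !ocontent_dmul -finset.setUA finset.subsetUl.
exists a => //; rewrite !ocontent_dmul !finset.in_setU /ocontent /= content_gen.
by rewrite finset.in_set1 eqxx orbT.
Qed.

Lemma option_tuple (X : I -> option (pseudoword A)) : (forall i j, oeqV V (X i) (X j)) ->
  (forall i, X i = None) \/ exists2 x, constV V x & forall i, X i = Some (x i).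
Proof.
move=> XX; case E : (X i0) => [z|].
  right; have Xi i : exists z', X i = Some z'.
    have := XX i0 i _ (DO_bar_orbs HH) (fun _ => true); rewrite E.
    by case: (X i) => [z'|] // _; exists z'.
  have [x xP] := choice Xi; exists x => // i j S VS f.
  by have := XX i j S VS f; rewrite !xP => -[].
left=> i; have := XX i0 i _ (DO_bar_orbs HH) (fun _ => true); rewrite E.
by case: (X i).
Qed.

Definition block B p := [/\ constV V p, reducibleT p & forall i, content (p i) = B].

Section Blocks.
Variables (d : bool) (B : {set A}).
Hypothesis IH : forall v, constV V v -> (forall i, (#|content (v i)| < #|B|)%N) -> reducibleT v.

(** The block is p = x a as in [last_first_occurrence]; induction applies to x, which misses a. If
    the remainder y is empty or loses a letter, the factorization stops and u is not regular: u = u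
    m u would give y = y m u by uniqueness, and thus full content. *)
Lemma block_step u : constV V u -> (forall i, content (u i) = B) ->
  (reducibleT u /\ ~ reg u) \/ exists p y,
  [/\ block B p, constV V y, forall i, content (y i) = B, u = tmul d p y & reg u -> reg y].
Proof.
move=> Vu uB; have [a [x0 [y0 [E0 ax0 Bx0]]]] := last_first_occurrence d (u i0).
have aB : a \in B by rewrite -(uB i0) Bx0 finset.in_setU finset.in_set1 eqxx.
have /choice[XY XYP] : forall i, exists xy : option (pseudoword A) * option (pseudoword A),
    Some (u i) = dmul d (dmul d xy.1 (Some (pw_gen _ a))) xy.2 /\ a \notin ocontent xy.1.
  move=> i; have [|x [y E]] := dmul_first_occurrence d (w := u i) (a := a); first by rewrite uB.
  by exists (x, y).
pose X i := (XY i).1; pose Y i := (XY i).2.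
have E i : Some (u i) = dmul d (dmul d (X i) (Some (pw_gen _ a))) (Y i) by case: (XYP i).
have aX i : a \notin ocontent (X i) by case: (XYP i).
have XX i j : oeqV V (X i) (X j).
  by case: (dmul_first_occurrence_unique HH (Vu i j) (E i) (aX i) (E j) (aX j)).
have YY i j : oeqV V (Y i) (Y j).
  by case: (dmul_first_occurrence_unique HH (Vu i j) (E i) (aX i) (E j) (aX j)).
have BX i : B = (a |: ocontent (X i))%SET.
  rewrite -(uB i0) Bx0; congr (_ :|: _)%SET; apply: (oeqV_ocontent HH).
  by case: (dmul_first_occurrence_unique HH (Vu i0 i) E0 ax0 (E i) (aX i)).
have [p [[Vp rp pB] pE]] : exists p, block B p /\
    forall i, Some (p i) = dmul d (X i) (Some (pw_gen _ a)).
  have [X0|[x Vx xE]] := option_tuple XX.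
    exists (fun _ => pw_gen _ a); split; last by move=> i; rewrite X0 /dmul; case: d.
    split; [by []|exact: reducible_gen|move=> i].
    by rewrite content_gen (BX i) X0 finset.setU0.
  exists (tmul d x (fun _ => pw_gen _ a)); split; last by move=> i; rewrite xE dmul_Some.
  split; first exact: constV_tmul.
    apply: reducible_tmul; last exact: reducible_gen.
    apply: IH => // i; apply: proper_card; rewrite (BX i) xE.
    apply/fintype.properP; split; first exact: finset.subsetUr.
    exists a; first by rewrite finset.in_setU finset.in_set1 eqxx.
    by have := aX i; rewrite xE.
  by move=> i; rewrite content_dmul content_gen (BX i) xE finset.setUC.
have E' i : Some (u i) = dmul d (Some (p i)) (Y i) by rewrite pE.
have regY m : (forall i, eqV V (u i) (u i * m * u i)) ->
    forall i, oeqV V (Y i) (dmul d (dmul d (Y i) (Some m)) (Some (u i))).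
  move=> um i.
  have Em : Some (u i * m * u i) = dmul d (dmul d (X i) (Some (pw_gen _ a)))
      (dmul d (dmul d (Y i) (Some m)) (Some (u i))).
    by rewrite !dmulA -E !dmul_Some; congr Some; case: (d); rewrite /dmul ?mulgA.
  by case: (dmul_first_occurrence_unique HH (um i) (E i) (aX i) Em (aX i)).
have [Y0|[y Vy yE]] := option_tuple YY.
  left; split.
    have -> : u = p; last by [].
    by apply/funext => i; have := E' i; rewrite Y0; case: (d) => -[].
  by case=> m /regY/(_ i0) /(_ _ (DO_bar_orbs HH) (fun _ => true)); rewrite Y0; case: (d).
have uE : u = tmul d p y.
  by apply/funext => i; have := E' i; rewrite yE dmul_Some => -[].
case: (eqVneq (content (y i0)) B) => [yB|yB]; last first.
  have yBi i : content (y i) \proper B.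
    rewrite (constV_content Vy i i0) finset.properEneq yB -(uB i0) uE.
    by rewrite content_dmul finset.subsetUr.
  left; split.
    by rewrite uE; apply: reducible_tmul => //; apply: IH => // i; exact: proper_card.
  case=> m /regY/(_ i0) /(oeqV_ocontent HH); rewrite yE !dmul_Some.
  rewrite /ocontent /= !content_dmul uB => yB'.
  by have := yBi i0; rewrite fintype.properE => /andP[_ /negP[]]; rewrite yB' finset.subsetUr.
right; exists p, y; split=> //.
  by move=> i; rewrite (constV_content Vy i i0).
(* In y = y m u the factor u is p y, so m p is a witness for y; as [p] is constant over [V], [p i0]
   serves for all indices. *)
case=> m um; exists (dmul d m (p i0)) => i S VS f.
have [yi] : oev (Some (y i)) f = oev (Some (dmul d (dmul d (y i) m) (u i))) f.
  by have := regY m um i S VS f; rewrite yE !dmul_Some.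
rewrite [LHS]yi; have mp : eqV V (dmul d m (p i)) (dmul d m (p i0)) by apply: eqV_dmul.
have -> : dmul d (dmul d (y i) m) (u i) = y i * dmul d m (p i) * y i.
  by rewrite uE /tmul !dmulA; case: (d); rewrite /dmul !mulgA.
by apply: (eqV_mul _ _ VS f) => //; exact: eqV_mul.
Qed.

(** The blocks between two stages are recorded because one of them will be the base of an omega
    power. *)
Lemma block_iter k u : constV V u -> (forall i, content (u i) = B) ->
  (reducibleT u /\ ~ reg u) \/ exists pre post : nat -> I -> pseudoword A,
    (forall j, (j <= k)%N -> [/\ block B (pre j), constV V (post j),
      forall i, content (post j i) = B, u = tmul d (pre j) (post j) & reg u -> reg (post j)]) /\
    (forall q j, (q < j <= k)%N -> exists2 M, block B M & pre j = tmul d (pre q) M).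
Proof.
move=> Vu uB; elim: k => [|k IHk].
  have [|[p [y [bp Vy yB uE ry]]]] := block_step Vu uB; first by left.
  right; exists (fun _ => p), (fun _ => y); split=> //.
  by move=> q j /andP[qj]; rewrite leqn0 => /eqP j0; rewrite j0 in qj.
case: IHk => [|[pre [post [preP mid]]]]; first by left.
have [[Vp rp pB] Vy yB uE ry] := preP k (leqnn k).
have [[rpost npost]|[p [y [bp Vy' yB' yE ry']]]] := block_step Vy yB.
  by left; split; [rewrite uE; exact: reducible_tmul|move/ry].
have block_mul p1 p2 : block B p1 -> block B p2 -> block B (tmul d p1 p2).
  move=> [V1 r1 B1] [V2 r2 B2]; split; [exact: constV_tmul|exact: reducible_tmul|].
  by move=> i; rewrite content_dmul B1 B2 finset.setUid.
have tmulA : associative (tmul d) by move=> x1 x2 x3; apply/funext => i; exact: dmulA.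
right; exists (fun j => if (j <= k)%N then pre j else tmul d (pre k) p).
exists (fun j => if (j <= k)%N then post j else y); split=> [j jk|q j /andP[qj jk]].
  case: ifP => jk'; first exact: preP.
  split=> //; [exact: block_mul|by rewrite -tmulA -yE|by move/ry].
have qk : (q <= k)%N by rewrite -ltnS; exact: leq_trans jk.
rewrite qk; case: ifP => jk'; first by apply: mid; rewrite qj.
case: (ltngtP q k) qk => // [qk _|-> _]; last by exists p.
by have [|M bM ->] := mid q k; [rewrite qk leqnn|exists (tmul d M p); [exact: block_mul|]].
Qed.

Lemma block_stable u : constV V u -> (forall i, content (u i) = B) ->
  (reducibleT u /\ ~ reg u) \/ exists p M y,
  [/\ block B p /\ block B M, constV V y /\ (forall i, content (y i) = B),
      u = tmul d (tmul d p M) y, forall i, Phi (p i) = dmul d (Phi (p i)) (Phi (M i))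
    & reg u -> reg y].
Proof.
move=> Vu uB; pose k := #|{ffun I -> F}|.
have [|[pre [post [preP mid]]]] := block_iter k Vu uB; first by left.
right; pose g (j : 'I_k.+1) := [ffun i => Phi (pre j i)].
have /injectivePn[q [j qj gqj]] : ~~ injectiveb g.
  by apply/negP => /injectiveP /leq_card; rewrite card_ord ltnn.
wlog lqj : q j qj gqj / (q < j)%N => [W|].
  case: (ltngtP q j) => [/W|/W|/val_inj E]; first by apply.
  - by apply; rewrite // eq_sym.
  - by rewrite E eqxx in qj.
have jk : (j <= k)%N by rewrite -ltnS.
have [bq _ _ _ _] := preP q (leq_trans (ltnW lqj) jk).
have [_ Vy yB uE ry] := preP j jk.
have [|M bM jE] := mid q j; first by rewrite lqj.
exists (pre q), M, (post j); split=> //; first by rewrite -jE.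
move=> i; have := congr1 (fun h : {ffun I -> F} => h i) gqj; rewrite !ffunE => E.
by rewrite {1}E jE; case: (d); rewrite /tmul /dmul gmulfM.
Qed.

End Blocks.

Lemma constV_reducible u : constV V u -> reducible (fun w => reg u -> idemV H w -> idemV V w) u.
Proof.
have [n] := ubnP #|content (u i0)|; elim: n u => // n IHn u.
rewrite ltnS => un Vu; pose B := content (u i0).
have IH v : constV V v -> (forall i, (#|content (v i)| < #|B|)%N) -> reducibleT v.
  move=> Vv vB; apply: reducible_weaken (IHn v _ Vv) => //.
  exact: leq_trans (vB i0) un.
have uB i : content (u i) = B by exact: constV_content.
(* The extra condition is vacuous for a tuple that is not regular, which is the case whenever a
   factorization stops. *)
have Qneg v : reducibleT v /\ ~ reg v -> reducible (fun w => reg v -> idemV H w -> idemV V w) v.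
  by case=> rv nv; apply: reducible_weaken rv => w _ /nv.
have [/Qneg //|[P [M [y [[[VP rP PB] [VM rM MB]] [Vy yB] uE PhiP ry]]]]] :=
  block_stable false IH Vu uB.
(* The remainder is now factored from the right, giving u = P M t N Q. *)
have [[rely nreg]|[Q [N [t [[[VQ rQ QB] [VN rN NB]] [Vt tB] yE PhiQ _]]]]] :=
  block_stable true IH Vy yB.
  apply: Qneg; split; last by move/ry.
  by rewrite uE; do 2 (apply: reducible_tmul => //).
have uE' : u = fun i => P i * M i * t i * N i * Q i.
  by rewrite uE yE; apply/funext => i; rewrite /tmul /dmul !mulgA.
rewrite uE'; apply: (@reducible_weaken (fun w => idemV H w -> idemV V w)) => //.
apply: (@reducible_sandwich B) => //; rewrite -?uE' //.
- by move=> i j; exact: eqV_H.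
- by move=> i; rewrite PB.
- by move=> i; rewrite tB.
- by move=> i; rewrite QB.
- by move=> i; rewrite gmulfM [LHS]PhiP.
- by move=> i; rewrite gmulfM [LHS]PhiQ.
Qed.

End Factorization.

(** * Reduction to a graph system over H *)

Section GroupEquations.
Variables (H : semigroup_class) (HH : group_pseudovariety H).
Variable A : finType.
Implicit Types v x y : pseudoword A.

Lemma eqV_H_cancel v x y : eqV H (v * x) (v * y) -> eqV H x y.
Proof.
move=> vxy G HG f; have [e [eu ei]] := HH.2 _ HG.
have [t [tv _]] := ei (ev v f); have := vxy G HG f; rewrite !evM => /(congr1 (mul t)).
by rewrite !mulgA tv (proj1 (eu (ev x f))) (proj1 (eu (ev y f))).
Qed.

(** Over groups v x = v means x = 1, which is expressed by idempotency since there is no empty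
    pseudoword. *)
Lemma eqV_H_stabilizer v x : eqV H (v * x) v -> eqV H x (x * x).
Proof.
move=> vx; apply: (@eqV_H_cancel v) => G HG f.
by rewrite mulgA (evM (_ * _)) !(vx G HG) -evM vx.
Qed.

End GroupEquations.

Lemma Forall2_map (T U : Type) (R : U -> U -> Prop) (f g : T -> U) (s : seq T) :
  (forall t, R (f t) (g t)) -> List.Forall2 R (map f s) (map g s).
Proof. by move=> Rfg; elim: s => [|t s IH]; constructor. Qed.

Lemma map_nth_ord (T : Type) (x0 : T) (s : seq T) :
  [seq nth x0 s (val j) | j <- enum 'I_(size s)] = s.
Proof. by rewrite (map_comp (nth x0 s) val) val_enum_ord map_nth_iota0 // take_size. Qed.

(* The equations expressing that the tuples in [L] are constant over H and that
   their product is idempotent form a graph system on a cycle of length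
   [size L], with the entries of the j-th tuple labelling parallel edges. *)
Lemma cycle_reducible (sigma : signature) (H : semigroup_class) (A : finType)
    (F : finSemigroupType) (Phi : {multiplicative pseudoword A -> F}) (I : finType)
    (i0 : I) (u : I -> pseudoword A) (L : seq (I -> pseudoword A)) :
  group_pseudovariety H -> graph_reducible sigma H -> onto_continuous Phi ->
  idemV H u -> List.Forall (constV H) L -> (forall i, lprod L i = Some (u i)) ->
  exists L', List.Forall2 (refines H sigma Phi (I := I)) L L' /\
    forall i z, oeqV H (Some z) (lprod L' i) -> eqV H z (z * z).
Proof.
move=> HH Hred Phioc uu LH LE.
pose x0 : I -> pseudoword A := fun=> u i0.
case EL : (size L) => [|K]; first by have := LE i0; rewrite (size0nil EL).
pose Gamma := Digraph (fun e : 'I_K.+1 * I => e.1) (fun e => ordS e.1).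
(* Vertex labels must be pseudowords, so the initial products of [L] are preceded by [u i0]; the
   cycle closes because [u i0] is idempotent over H. *)
pose pref j := odflt (u i0) (Some (u i0) * lprod (take j L) i0).
have prefE j : Some (pref j) = Some (u i0) * lprod (take j L) i0.
  by rewrite /pref; case: (lprod _ _).
pose gamma (x : vertex Gamma + edge Gamma) : pseudoword A :=
  match x with inl j => pref j | inr e => nth x0 L (e.1 : 'I_K.+1) e.2 end.
have LHnth j : (j < size L)%N -> constV H (nth x0 L j).
  elim: LH j => // l L0 Hl _ IH [|j] //=; exact: IH.
have [|gamma' [[PhiG eqG] sG]] := Hred Gamma A F Phi (Phi \o gamma) Phioc.
  exists gamma; split=> // -[j i] /=; apply/pw_projP.
  have jL : (j < size L)%N by rewrite EL.
  have step : Some (pref j.+1) = Some (pref j * nth x0 L j i0).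
    by rewrite -omulE !prefE (take_nth x0 jL) -cats1 lprod_cat /= omulr1 mulgA.
  have H1 : eqV H (pref j * nth x0 L j i) (pref j.+1).
    case: step => ->; apply: eqV_mul => //; exact: LHnth.
  move=> G HG f; rewrite H1 //.
  case: (ltngtP j.+1 K.+1) (ltn_ord j) => // [jK _|jK _]; first by rewrite modn_small.
  rewrite jK modnn; have := prefE K.+1; rewrite -EL take_size LE omulE => -[->].
  have := prefE 0%N; rewrite take0 /= => -[->].
  by rewrite -(uu i0 G HG f).
pose L' : seq (I -> pseudoword A) := [seq (fun i => gamma' (inr (j, i))) | j <- enum 'I_K.+1].
have edgeG j i : eqV H (gamma' (inl j) * gamma' (inr (j, i))) (gamma' (inl (ordS j))).
  by apply/pw_projP; exact: (eqG (j, i)).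
exists L'; split.
  rewrite -[L](map_nth_ord x0) EL; apply: Forall2_map => j; split.
  - by move=> i; apply: sigma_add_omega; exact: sG.
  - by move=> i; exact: (PhiG (inr (j, i))).
  (* Parallel edges share their endpoints, so cancellation over H identifies their labels. *)
  - move=> i i'; apply: (eqV_H_cancel HH (v := gamma' (inl j))) => G HG f.
    by rewrite !edgeG.
(* Reducing indices modulo the length brings the full product back to the initial vertex, so that v
   z = v over H. *)
move=> i z zE; pose vv m := gamma' (inl (inord (m %% K.+1))).
have vvP m : (m <= K.+1)%N -> oeqV H (Some (vv 0%N) * lprod (take m L') i) (Some (vv m)).
  elim: m => [|m IH] mK; first by rewrite take0.
  have sL' : (m < size L')%N by rewrite size_map size_enum_ord.
  rewrite (take_nth x0 sL') -cats1 lprod_cat mulgA => G HG f.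
  rewrite oevM IH ?(ltnW mK) //=.
  have -> : nth x0 L' m i = gamma' (inr (inord m, i)).
    rewrite (nth_map ord0) ?size_enum_ord //; congr (gamma' (inr (_, i))).
    by apply: val_inj; rewrite /= nth_enum_ord ?inordK.
  rewrite omulE -evM -/(vv m) /vv (modn_small mK) edgeG //.
  congr (Some (ev (gamma' (inl _)) f)); apply: val_inj.
  by rewrite /= !inordK // ltn_pmod.
apply: (eqV_H_stabilizer HH (v := vv 0%N)) => G HG f.
have := vvP K.+1 (leqnn _) G HG f.
rewrite take_oversize; last by rewrite size_map size_enum_ord.
rewrite oevM -(zE G HG f) /vv modnn.
by case.
Qed.

Theorem theorem4p3 (sigma0 : signature) (H : semigroup_class)
    (Hsigma0 : implicit_signature sigma0)
    (HH : group_pseudovariety H)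
    (Hred : graph_reducible sigma0 H)
    (S : finSemigroupType) (A : finType)
    (phi : {multiplicative pseudoword A -> S}) (Hphi : onto_continuous phi)
    (n : nat) (s : 'I_n.+1 -> S)
    (Hs : idempotent_pointlike (DO_bar H) (range s))
    (u : 'I_n.+1 -> pseudoword A)
    (Hu : forall i, phi (u i) = s i)
    (HuV : forall i, pw_proj (DO_bar H) (u i) =
                     pw_proj (DO_bar H) (u ord_max * u ord_max)) :
  exists w : 'I_n.+1 -> pseudoword A,
    [/\ forall i, sigma_subalgebra (add_omega sigma0) (w i),
        forall i, phi (w i) = s i
      & forall i, pw_proj (DO_bar H) (w i) =
                  pw_proj (DO_bar H) (w ord_max * w ord_max)].
Proof.
have [F [Phi [Phioc Phiphi Phicont Phigen]]] := refine_hom Hphi.1.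
have uV i : eqV (DO_bar H) (u i) (u ord_max * u ord_max) by apply/pw_projP.
have uE (T : finSemigroupType) (f : A -> T) i : DO_bar H T -> ev (u i) f = ev (u ord_max) f.
  by move=> VT; rewrite (uV i T VT) -(uV ord_max T VT).
have uu (T : finSemigroupType) (f : A -> T) i : DO_bar H T ->
    ev (u i) f * ev (u i) f = ev (u i) f.
  by move=> VT; rewrite (uE _ f i VT) -evM -(uV ord_max T VT).
have Vu : constV (DO_bar H) u by move=> i j T VT f; rewrite !(uE _ f).
have [_ [L [LE LH Lred]]] := constV_reducible HH Hsigma0 Phicont Phigen
  (fun w => hom_omega w Phioc.1) ord0 Vu.
have uuH : idemV H u by move=> i; apply: (eqV_H HH) => T VT f; rewrite evM uu.
have [L' [/Lred[w [sw Phiw Vw Hw Qw]] L'one]] := cycle_reducible ord0 HH Hred Phioc uuH LH LE.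
(* Over [V] all entries equal one idempotent, so any entry is a common witness of regularity. *)
have regu : reg H u.
  by exists (u ord0) => i T VT f; rewrite !evM (uE _ f ord0) // -(uE _ f i VT) !uu.
have ww : idemV (DO_bar H) w.
  by apply: (Qw regu) => i; exact: L'one.
exists w; split=> // i; first by rewrite -Hu; exact: Phiphi.
by apply/pw_projP => T VT f; rewrite (Vw i ord_max T VT f) -(ww ord_max T VT).
Qed.
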